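(* Let $\mathcal{H}=\mathrm{Forb}(K_{2,3})$. Then for all $p\in[0,1]$, $$\mathrm{ed}_{\mathcal{H}}(p)=\min\left\{p(1-p),\frac{1-p}{2}\right\},$$ and $p^*_{\mathcal{H}}=\frac12$, $d^*_{\mathcal{H}}=\frac14$.
   Context: All graphs are finite and simple. $K_{2,t}$ is the complete bipartite graph with parts of sizes $2$ and $t$. For a graph $H$, $\mathrm{Forb}(H)$ is the hereditary property consisting of all graphs with no induced subgraph isomorphic to $H$. For graphs $G,G'$ on the same labeled vertex set, $\mathrm{dist}(G,G')=|E(G)\,\Delta\, E(G')|$; for a hereditary property $\mathcal{H}$ (a set of graphs closed under isomorphism and vertex deletion), $\mathrm{dist}(G,\mathcal{H})=\min\{\mathrm{dist}(G,G'): G'\in\mathcal{H},\ V(G')=V(G)\}$. The edit distance function is $$\mathrm{ed}_{\mathcal{H}}(p)=\lim_{n\to\infty}\max\left\{\mathrm{dist}(G,\mathcal{H}): |V(G)|=n,\ |E(G)|=\left\lfloor p\tbinom n2\right\rfloor\right\}\Big/\tbinom n2,\qquad p\in[0,1].$$ (The limit is known to exist, and the function is known to be continuous and concave.) $d^*_{\mathcal{H}}$ denotes the maximum value of $\mathrm{ed}_{\mathcal{H}}$ on $[0,1]$, and $p^*_{\mathcal{H}}$ denotes the point, or the interval of points, at which this maximum is attained; $p^*_{\mathcal H}=a$ means the maximum is attained exactly at $a$. *)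

(* Defs.v *)
From HB Require Import structures.
From mathcomp Require Import all_boot all_order all_algebra.
From mathcomp Require Import all_classical all_reals all_analysis.

Set Implicit Arguments.
Unset Strict Implicit.
Unset Printing Implicit Defensive.

Import Order.TTheory GRing.Theory Num.Theory.
Import numFieldNormedType.Exports.

Local Open Scope classical_set_scope.
Local Open Scope ring_scope.

(* A finite simple graph on the labeled vertex set V, given by its edge set: a
   set of two-element subsets of V. *)
Record graph (V : finType) := Graph {
  edges :> {set {set V}};
  edges_card2 : [forall e in edges, #|e| == 2%N] }.

HB.instance Definition _ (V : finType) := [isSub for @edges V].
HB.instance Definition _ (V : finType) := [Finite of graph V by <:].

Definition adj (V : finType) (G : graph V) (x y : V) : bool :=
  [set x; y]%SET \in edges G.

Definition isomorphic (V W : finType) (G : graph V) (H : graph W) : bool :=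
  [exists f : {ffun V -> W},
    [&& injectiveb f, [forall w, w \in codom f]
      & [forall x, forall y, adj G x y == adj H (f x) (f y)]]].

Lemma induced_card2 (V : finType) (G : graph V) (S : {set V}) :
  [forall e in [set e : {set {x | x \in S}} | (val @: e)%SET \in edges G]%SET,
    #|e| == 2%N].
Proof.
apply/forall_inP => e; rewrite inE => eG.
by rewrite -(card_imset _ val_inj) (forall_inP (edges_card2 G) _ eG).
Qed.

Definition induced (V : finType) (G : graph V) (S : {set V}) :
  graph {x | x \in S} := Graph (induced_card2 G S).

Lemma complete_bipartite_card2 (s t : nat) :
  [forall e in [set [set inl ij.1; inr ij.2] | ij : 'I_s * 'I_t]%SET,
    #|(e : {set 'I_s + 'I_t})| == 2%N].
Proof. by apply/forall_inP => e /imsetP [ij _ ->]; rewrite cards2. Qed.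

Definition complete_bipartite (s t : nat) : graph ('I_s + 'I_t)%type :=
  Graph (complete_bipartite_card2 s t).

Definition graph_property := forall V : finType, pred (graph V).

Definition Forb (W : finType) (H : graph W) : graph_property :=
  fun V G => ~~ [exists S : {set V}, isomorphic (induced G S) H].

Definition dist (V : finType) (G G' : graph V) : nat :=
  #|(edges G :\: edges G') :|: (edges G' :\: edges G)|.

(* A minimum over the graphs on V with property P. The default value of the
   big operator bounds every dist G G', so it is irrelevant as soon as some
   graph on V has property P. *)
Definition dist_property (P : graph_property) (V : finType) (G : graph V) :
    nat :=
  \big[minn/'C(#|V|, 2)]_(G' : graph V | P V G') dist G G'.

Definition max_dist (R : realType) (P : graph_property) (p : R) (n : nat) :
    nat :=
  \max_(G : graph 'I_n | #|edges G|%:Z == Num.floor (p * 'C(n, 2)%:R))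
    dist_property P G.

Definition edit_ratio (R : realType) (P : graph_property) (p : R) (n : nat) :
    R :=
  (max_dist P p n)%:R / 'C(n, 2)%:R.

Definition ed (R : realType) (P : graph_property) (p : R) : R :=
  limn (edit_ratio P p).

Definition p_star (R : realType) (P : graph_property) : set R :=
  [set p | 0 <= p <= 1 /\ forall q, 0 <= q <= 1 -> ed P q <= ed P p].
Arguments p_star : clear implicits.

(* The greatest element of the set of values of ed on [0, 1], with a junk value
   0 if there is none. *)
Definition d_star (R : realType) (P : graph_property) : R :=
  let values := [set ed P p | p in [set p | 0 <= p <= 1]] in
  xget 0 (values `&` ubound values).
Arguments d_star : clear implicits.

(* Main.v *)
(* Upper bound: in a random 2-colouring of the vertices, delete the edges inside
   one colour class and complete the other one (a split graph), or complete both
   classes (a co-bipartite graph); neither kind of graph contains an induced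
   K_{2,3}, and the expected number of edits is the claimed one.

   Lower bound: take G quasirandom of density p and G' free of induced K_{2,3}.
   Szemeredi's regularity lemma gives a partition for G' into cells; call a cell
   black or white according to its internal edge density, and a regular pair
   white, black or gray according to whether its density is near 0, near 1 or
   neither. By quasirandomness of G the number of edits is at least the quadratic
   form that charges p for white, 1 - p for black and 0 for gray. A counting lemma
   forbids some gray configurations. For p >= 1/2 the absence of gray triangles
   and Mantel's theorem suffice; for p <= 1/2 one studies a minimizer with minimal
   support, where two cells at gray distance two have at most two common gray
   neighbours, and counts weighted second neighbourhoods of the heaviest cell. *)
Require Import Defs.
From mathcomp Require Import all_boot all_order all_algebra all_field.
From mathcomp Require Import all_classical all_reals all_analysis.
From mathcomp Require Import ring lra.

Set Implicit Arguments.
Unset Strict Implicit.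
Unset Printing Implicit Defensive.

Import Order.TTheory GRing.Theory Num.Theory.
Import numFieldNormedType.Exports.

Local Open Scope ring_scope.

(** * Minimizing a quadratic form on the simplex *)

(** The colour of a cell records only what can be found inside it, since regularity says nothing
    there. Internal density at least 1/20 yields no more than an edge on two prescribed coordinates,
    so the pattern for a black gray triangle uses a single inner edge in each of two cells; below
    1/20 a union bound yields independent triples. Edits inside cells are never estimated: the
    partition refines residue classes modulo a large [m], so pairs inside cells are negligible and
    the form may charge its diagonal freely. For p <= 1/2 the benefit of minimal support is that it
    excludes black pairs: every non-adjacency demanded by a K_{2,3} of cells then holds
    automatically, and only its gray pairs remain to be found. The extremal graph must have exactly
    floor(p C(n,2)) edges. An explicit affine-plane graph over a field of order 2^k takes the place
    of a random graph, and a few of its edges are then changed. The constants are fixed in the order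
    [d], [e], [m], the bound [K] on the number of cells, [eta], and finally [n]. *)

Definition simplex (R : realType) (C : finType) (x : C -> R) :=
  (forall i, 0 <= x i) /\ \sum_i x i = 1.

Definition quad (R : realType) (C : finType) (M : C -> C -> R) (x : C -> R) :=
  \sum_i \sum_j x i * M i j * x j.

Lemma continuous_sum (R : realType) (T : topologicalType) (I : finType)
    (F : I -> T -> R) :
  (forall i, continuous (F i)) -> continuous (fun v => \sum_i F i v).
Proof.
move=> cF; elim: (index_enum I) => [|i s IH] v.
  by under eq_fun do rewrite big_nil; exact: cvg_cst.
under eq_fun do rewrite big_cons.
by apply: continuousD; [exact: cF|exact: IH].
Qed.

(** Compactness: the simplex is a closed hyperplane section of the unit cube. Functions on [C] are
    coded as row vectors so that the extreme value theorem applies. *)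
Lemma simplex_argmin (R : realType) (C : finType) (M : C -> C -> R)
    (x0 : C -> R) : simplex x0 ->
  exists2 x, simplex x & forall y, simplex y -> quad M x <= quad M y.
Proof.
move=> sx0.
pose n := #|C|; pose f (v : 'rV[R]_n) i := v ord0 (@enum_rank C i).
pose A : set 'rV[R]_n := [set v | simplex (f v)]%classic.
have cf i : continuous (fun v => f v i) by exact: coord_continuous.
pose g x : 'rV[R]_n := \row_k x (@enum_val C _ k).
have fg x : f (g x) = x by apply/funext => i; rewrite /f mxE enum_rankK.
have [|||v vA vmin] := @EVT_min_rV R n (fun v => quad M (f v)) A.
- by exists (g x0); rewrite /A /= fg.
- have -> : A = ([set v : 'rV[R]_n | forall i, `[0, 1]%classic (v ord0 i)] `&`
                (fun v => \sum_i f v i) @^-1` [set 1])%classic.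
    apply/seteqP; split=> v /=.
      move=> [v0 v1]; split=> // i; rewrite in_itv /=.
      have fi : v ord0 i = f v (enum_val i) by rewrite /f enum_valK.
      rewrite fi v0 -v1 /= (bigD1 (enum_val i)) //= lerDl sumr_ge0 //.
    move=> [v0 v1]; split=> // i.
    by have := v0 (enum_rank i); rewrite in_itv /= => /andP [].
  apply: compact_closedI; last first.
    have cs : continuous (fun v : 'rV[R]_n => \sum_i f v i) by exact: continuous_sum.
    by apply: preimage_closed => //; exact: closed_eq.
    have := @rV_compact R n (fun=> `[0, 1]%classic).
    by apply=> i; exact: segment_compact.
- apply: continuous_subspaceT; apply: continuous_sum => i.
  apply: continuous_sum => j v.
  have cc : continuous (fun _ : 'rV[R]_n => M i j) by exact: cst_continuous.
  have := @continuousM R _ _ _ v (@continuousM R _ _ _ v (cf i v) (cc v)) (cf j v).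
  exact.
exists (f v); first by move: vA; rewrite inE.
move=> y sy; have := vmin (g y); rewrite fg; apply.
by rewrite inE /A /= fg.
Qed.

Lemma quadD (R : realType) (C : finType) (M : C -> C -> R) (x z : C -> R) (t : R) :
  (forall i j, M i j = M j i) ->
  quad M (fun k => x k + t * z k) =
  quad M x + 2 * t * (\sum_i z i * \sum_j M i j * x j) + t ^+ 2 * quad M z.
Proof.
move=> Msym; rewrite /quad.
have -> : \sum_i z i * \sum_j M i j * x j = \sum_i \sum_j z i * M i j * x j.
  by apply: eq_bigr => i _; rewrite big_distrr /=; apply: eq_bigr => j _; rewrite mulrA.
have -> : 2 * t * (\sum_i \sum_j z i * M i j * x j) =
   t * (\sum_i \sum_j z i * M i j * x j) + t * (\sum_i \sum_j x i * M i j * z j).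
  have -> : \sum_i \sum_j x i * M i j * z j = \sum_i \sum_j z i * M i j * x j.
    rewrite exchange_big; apply: eq_bigr => i _; apply: eq_bigr => j _.
    by rewrite (Msym j i); ring.
  by ring.
rewrite !big_distrr -!big_split /=; apply: eq_bigr => i _.
rewrite !big_distrr -!big_split /=; apply: eq_bigr => j _.
by ring.
Qed.

Lemma sum_pair_diff (R : realType) (C : finType) (i j : C) (h : C -> R) :
  \sum_k ((k == i)%:R - (k == j)%:R) * h k = h i - h j.
Proof.
have one a : \sum_k (k == a)%:R * h k = h a.
  rewrite (bigD1 a) //= eqxx mul1r big1 ?addr0 // => k /negPf ->.
  by rewrite mul0r.
by under eq_bigr do rewrite mulrBl; rewrite sumrB !one.
Qed.

(** First-order condition: if [e] were nonzero, the step [t = - s * e] would make the linear term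
    win. The two bounds on [s] keep [t] in range and [s * D] below 2. *)
Lemma quad_ge0_local (R : realFieldType) (m e D : R) : 0 < m ->
  (forall t, `|t| <= m -> 0 <= 2 * t * e + t ^+ 2 * D) -> e = 0.
Proof.
move=> m0 H; apply/eqP; apply: contraT => e0.
have ne0 : 0 < `|e| by rewrite normr_gt0.
have D1 : 0 < `|D| + 1 by rewrite ltr_wpDl.
pose s := Num.min (m / `|e|) (1 / (`|D| + 1)).
have s0 : 0 < s by rewrite lt_min !divr_gt0.
have sm : s * `|e| <= m by rewrite -ler_pdivlMr // ge_min lexx.
have sD : s * (`|D| + 1) <= 1 by rewrite -ler_pdivlMr // ge_min lexx orbT.
have {H} := H (- (s * e)).
rewrite normrN normrM (gtr0_norm s0) => /(_ sm).
have -> : 2 * - (s * e) * e + (- (s * e)) ^+ 2 * D = - (s * e ^+ 2 * (2 - s * D)).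
  by ring.
have sDD : s * D <= s * `|D| by rewrite ler_pM2l // ler_norm.
rewrite oppr_ge0 leNgt => /negP []; apply: mulr_gt0.
  by rewrite mulr_gt0 // exprn_even_gt0.
by nra.
Qed.

(* Minimality of the support excludes [M i i + M j j <= 2 * M i j]: sliding all
   the mass of [i] to [j] would then give a minimizer with smaller support. *)
Lemma simplex_core (R : realType) (C : finType) (M : C -> C -> R)
    (x0 : C -> R) : simplex x0 -> (forall i j, M i j = M j i) ->
  exists x, [/\ simplex x, forall y, simplex y -> quad M x <= quad M y,
    forall i, 0 < x i -> \sum_j M i j * x j = quad M x &
    forall i j, i != j -> 0 < x i -> 0 < x j -> 2 * M i j < M i i + M j j].
Proof.
move=> sx0 Msym.
pose is_min x := simplex x /\ forall y, simplex y -> quad M x <= quad M y.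
pose P k := `[< exists2 x, is_min x & #|[pred i | 0 < x i]| = k >].
have [|k /asboolP [x [sx xmin] xk] kmin] := @ex_minnP P.
  have [x sx xmin] := simplex_argmin M sx0.
  by exists #|[pred i | 0 < x i]|; apply/asboolP; exists x.
have [x_ge0 x1] := sx.
pose z (i j k : C) : R := (k == i)%:R - (k == j)%:R.
pose L i := \sum_j M i j * x j.
pose D i j := M i i + M j j - 2 * M i j.
have zD i j t : quad M (fun k => x k + t * z i j k) =
    quad M x + 2 * t * (L i - L j) + t ^+ 2 * D i j.
  rewrite quadD // sum_pair_diff; congr (_ + _ * _).
  rewrite /quad; under eq_bigr => a _ do under eq_bigr => b _ do rewrite -mulrA.
  under eq_bigr => a _ do rewrite -big_distrr /=.
  rewrite sum_pair_diff.
  have e a : \sum_k M a k * z i j k = M a i - M a j.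
    by under eq_bigr do rewrite mulrC; rewrite sum_pair_diff.
  by rewrite !e (Msym j i) /D; ring.
have sz i j t : i != j -> - x i <= t -> t <= x j ->
    simplex (fun k => x k + t * z i j k).
  move=> ij ti tj; split=> [l|]; last first.
    rewrite big_split /= -big_distrr /= x1.
    have := sum_pair_diff i j (fun=> 1 : R); rewrite /= subrr.
    by under eq_bigr do rewrite mulr1; move=> ->; rewrite mulr0 addr0.
  rewrite /z; case: (eqVneq l i) => [->|li].
    by rewrite (negPf ij) subr0 mulr1; lra.
  case: (eqVneq l j) => [->|lj]; first by rewrite sub0r mulrN mulr1; lra.
  by rewrite subr0 mulr0 addr0.
(* Both weights are positive, so mass can move in either direction and the derivative [L i - L j]
   must vanish. *)
have Leq i j : 0 < x i -> 0 < x j -> L i = L j.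
  move=> xi xj; case: (eqVneq i j) => [->//|ij].
  apply/eqP; rewrite -subr_eq0; apply/eqP.
  apply: (@quad_ge0_local _ (Num.min (x i) (x j)) _ (D i j)).
    by rewrite lt_min xi.
  move=> t; rewrite le_min !ler_norml => /andP [/andP [ti _] /andP [_ tj]].
  by have := xmin _ (sz i j t ij ti tj); rewrite zD; lra.
exists x; split=> //.
- move=> i xi; rewrite -/(L i).
  have -> : quad M x = \sum_j x j * L i.
    apply: eq_bigr => j _; have := x_ge0 j; rewrite le_eqVlt => /orP [/eqP <-|xj].
      by rewrite mul0r big1 // => l _; rewrite !mul0r.
    by rewrite (Leq i j) // big_distrr; apply: eq_bigr => l _; rewrite -mulrA.
  by rewrite -big_distrl /= x1 mul1r.
- move=> i j ij xi xj; rewrite ltNge; apply/negP => Dle.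
  have sy := sz i j (- x i) ij (lexx _) (le_trans (_ : - x i <= 0) (ltW xj)).
  rewrite oppr_le0 x_ge0 in sy; have {}sy := sy isT.
  have qy : quad M (fun k => x k + - x i * z i j k) <= quad M x.
    rewrite zD (Leq i j) // subrr mulr0 addr0.
    have := sqr_ge0 (- x i); rewrite /D; nra.
  set y := (fun k => _) in sy qy.
  have : (k <= #|[pred a | (0 < y a)%R]|)%N.
    apply: kmin; apply/asboolP; exists y => //; split=> // w sw.
    exact: le_trans (xmin _ sw).
  rewrite leqNgt -xk => /negP []; apply: proper_card.
  apply/properP; split.
    apply/fintype.subsetP => a; rewrite !inE /y /z.
    case: (eqVneq a j) => [->//|aj].
    case: (eqVneq a i) => [->//|ai]; by rewrite subr0 mulr0 addr0.
  by exists i; rewrite !inE // /y /z eqxx (negPf ij) subr0 mulr1 subrr ltxx.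
Qed.

(** * Coloured regularity graphs *)

(** Two relations are needed: they are complementary in a graph, but a gray pair of cells provides
    edges and non-edges at once. *)
Definition no_K23 (C : finType) (e ne : rel C) := forall a a' b b' b'',
  [&& a != a', b != b', b' != b'' & b != b''] ->
  [&& ne a a', ne b b', ne b' b'' & ne b b''] ->
  [&& e a b, e a b' & e a b''] -> [&& e a' b, e a' b' & e a' b''] -> False.

(* Cells are black ([blk]) or white, and pairs are gray, white ([nblk] but not
   [gray]) or black; a gray pair is in particular not black. *)
Record K23_free_crg (C : finType) (blk : pred C) (gray nblk : rel C) : Prop :=
  K23FreeCrg {
  crg_gray_sym : symmetric gray;
  crg_nblk_sym : symmetric nblk;
  crg_gray_irr : irreflexive gray;
  crg_gray_nblk : forall i j, gray i j -> nblk i j;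
  crg_white_white : forall i j, ~~ blk i -> ~~ blk j -> gray i j -> False;
  crg_white_black : forall i j k, ~~ blk i -> blk j -> blk k -> j != k ->
    gray i j -> gray i k -> nblk j k -> False;
  crg_black_black : forall i j k, blk i -> blk j -> blk k ->
    gray i j -> gray i k -> gray j k -> False;
  crg_K23 : no_K23 gray nblk }.

Definition crg_cost (R : realType) (C : finType) (p : R)
    (blk : pred C) (gray nblk : rel C) (i j : C) : R :=
  if i == j then if blk i then 1 - p else p
  else if gray i j then 0 else if nblk i j then p else 1 - p.

(** Two white cells already contradict [crg_white_white], a single white one contradicts
    [crg_white_black] because gray pairs are nonblack, and three black ones contradict
    [crg_black_black]. *)
Lemma crg_gray_triangle (C : finType) (blk : pred C) (gray nblk : rel C) :
  K23_free_crg blk gray nblk ->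
  forall i j k, gray i j -> gray i k -> gray j k -> False.
Proof.
move=> [gs ns gi gn WW WB BB _] i j k ij ik jk.
have neq a b : gray a b -> a != b by apply: contraTneq => ->; rewrite gi.
case: (boolP (blk i)) => bi; case: (boolP (blk j)) => bj; case: (boolP (blk k)) => bk.
- exact: (BB i j k).
- by apply: (WB k i j) => //; rewrite ?neq ?gn // gs.
- by apply: (WB j i k) => //; rewrite ?neq ?gn // gs.
- exact: (WW j k).
- by apply: (WB i j k) => //; rewrite ?neq ?gn // gs.
- exact: (WW i k).
- exact: (WW i j).
- exact: (WW i j).
Qed.

Lemma simplex_exists_gt0 (R : realType) (C : finType) (x : C -> R) :
  simplex x -> exists i, 0 < x i.
Proof.
move=> [x0 x1]; apply/existsP; apply: contraT; rewrite negb_exists => /forallP H.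
have : \sum_i x i = 0.
  apply: big1 => i _; apply/eqP; rewrite eq_le x0 andbT leNgt; exact: H.
by rewrite x1 => /eqP; rewrite oner_eq0.
Qed.

(** The Motzkin-Straus argument: the support of a minimal minimizer is a gray clique, hence has at
    most two cells, and all its weights equal the minimum. *)
Lemma mantel_weighted (R : realType) (C : finType) (gray : rel C) (x : C -> R) :
  symmetric gray -> irreflexive gray ->
  (forall i j k, gray i j -> gray i k -> gray j k -> False) ->
  simplex x -> 1 / 2 <= quad (fun i j => (~~ gray i j)%:R) x.
Proof.
move=> gs gi tri sx; set M := fun i j => _.
have Msym i j : M i j = M j i by rewrite /M gs.
have [y [sy ymin ycrit ypos]] := simplex_core sx Msym.
apply: le_trans (ymin _ sx).
have [y0 y1] := sy.
have cl i j : i != j -> 0 < y i -> 0 < y j -> gray i j.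
  move=> ij yi yj; have := ypos i j ij yi yj.
  by rewrite /M !gi; case: (gray i j) => //=; rewrite mulr1 mulr1n ltxx.
have yE i : 0 < y i -> y i = quad M y.
  move=> yi; rewrite -(ycrit _ yi) (bigD1 i) //= {1}/M gi mul1r big1 ?addr0 // => j ji.
  have := y0 j; rewrite le_eqVlt => /orP [/eqP <-|yj]; first by rewrite mulr0.
  by rewrite /M cl ?mul0r // eq_sym.
have : (#|[pred i | (0 < y i)%R]| <= 2)%N.
  rewrite leqNgt; apply/negP => /card_gt2P [i [j [k [[]]]]].
  rewrite !inE => yi yj yk [ij jk ki].
  by apply: (tri i j k); rewrite cl // eq_sym.
have : 1 = quad M y * #|[pred i | (0 < y i)%R]|%:R.
  rewrite -[X in X = _]y1 -sum1_card natr_sum big_distrr /= [RHS]big_mkcond /=.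
  apply: eq_bigr => i _; rewrite inE; case: ifP => [yi|/negbT]; first by rewrite mulr1 yE.
  by rewrite -leNgt => yi; apply/eqP; rewrite eq_le yi y0.
have [i yi] := simplex_exists_gt0 sy.
have := y0 i; rewrite yE // => g0 e le2.
have : #|[pred i | (0 < y i)%R]|%:R <= 2 :> R by rewrite (ler_nat _ _ 2).
nra.
Qed.

(** For p >= 1/2 every entry that is not gray costs at least [1 - p]. *)
Lemma crg_cost_ge_half (R : realType) (C : finType) (p : R)
    (blk : pred C) (gray nblk : rel C) (x : C -> R) :
  K23_free_crg blk gray nblk -> 1 / 2 <= p <= 1 -> simplex x ->
  (1 - p) / 2 <= quad (crg_cost p blk gray nblk) x.
Proof.
move=> free p12 sx; have [x0 _] := sx.
have := mantel_weighted (crg_gray_sym free) (crg_gray_irr free)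
  (crg_gray_triangle free) sx.
set Q := quad _ x => Q2; apply: (@le_trans _ _ ((1 - p) * Q)).
  by nra.
rewrite big_distrr; apply: ler_sum => i _; rewrite big_distrr.
apply: ler_sum => j _ /=; rewrite -!mulrA mulrCA; apply: ler_wpM2l => //.
rewrite mulrA; apply: ler_wpM2r => //.
rewrite /crg_cost; case: eqP => [->|_].
  by rewrite (crg_gray_irr free) mulr1; case: (blk j); lra.
by case: (gray i j); rewrite ?mulr0 // mulr1; case: ifP; lra.
Qed.

(* The contradiction closing the all-black case: [x] is the largest weight, [S]
   and [d] the total weight and the number of its gray neighbours, and [g] the
   value of the quadratic form. *)
Lemma black_core_arith (R : realFieldType) (p g x S d : R) :
  0 < p -> p < 1 / 2 -> g < p * (1 - p) -> 0 < x -> x < p -> 0 <= d ->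
  p * S = (p - g) + (1 - 2 * p) * x ->
  S <= d * x -> S <= d * (p - x) ->
  d * (p - g) + (1 - 2 * p) * S <= p * (d * x + 2 * (1 - x - S)) -> False.
Proof.
move=> p0 p12 gp x0 xp d0 ES dx dpx ineq.
have pS : p ^+ 2 + (1 - 2 * p) * x < p * S by nra.
have ineq2 : d * (p * (p - x)) + S <= 2 * p * (1 - x).
  have : d * p ^+ 2 <= d * (p - g) by apply: ler_wpM2l => //; lra.
  by lra.
(* The case split decides which of [S <= d * x] and [S <= d * (p - x)] is the stronger bound; it is
   used to eliminate [d]. *)
case: (lerP x (p / 2)) => xle.
  have h1 : S * (p * (p - x)) <= d * x * (p * (p - x)).
    by apply: ler_wpM2r => //; nra.
  have h2 : (d * (p * (p - x)) + S) * x <= 2 * p * (1 - x) * x.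
    by apply: ler_wpM2r => //; lra.
  have h3 : p * S * (p * (p - x) + x) <= 2 * p ^+ 2 * (1 - x) * x.
    have : p * (S * (p * (p - x)) + S * x) <= p * (2 * p * (1 - x) * x).
      by apply: ler_wpM2l; lra.
    by lra.
  have h4 : (p ^+ 2 + (1 - 2 * p) * x) * (p * (p - x) + x)
            < p * S * (p * (p - x) + x).
    by rewrite ltr_pM2r //; nra.
  have h5 : 0 <= p ^+ 2 * ((p - 2 * x) * (p - x)).
    by apply: mulr_ge0; [exact: sqr_ge0|apply: mulr_ge0; lra].
  have h6 : 0 <= (1 - 2 * p) * (1 - p) * x ^+ 2.
    by apply: mulr_ge0; [apply: mulr_ge0; lra|exact: sqr_ge0].
  by lra.
have h1 : p * S <= p * (d * (p - x)) by apply: ler_wpM2l => //; lra.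
have h2 : p * S * (1 + p) <= 2 * p ^+ 2 * (1 - x).
  have : p * (p * S + S) <= p * (2 * p * (1 - x)) by apply: ler_wpM2l; lra.
  by lra.
have h3 : (p ^+ 2 + (1 - 2 * p) * x) * (1 + p) < p * S * (1 + p).
  by rewrite ltr_pM2r //; lra.
have h4 : 0 < (1 - p) * (x - p / 2) by apply: mulr_gt0; lra.
have h5 : 0 < p * ((1 - p) * (1 - 2 * p)) by rewrite !mulr_gt0 //; lra.
by lra.
Qed.

Lemma crg_cost_ge_split (R : realType) (C : finType) (p : R)
    (blk : pred C) (gray nblk : rel C) (x0 : C -> R) :
  K23_free_crg blk gray nblk -> 0 <= p <= 1 / 2 -> simplex x0 ->
  p * (1 - p) <= quad (crg_cost p blk gray nblk) x0.
Proof.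
move=> free p12 sx0; set M := crg_cost _ _ _ _.
have [gs ns gi gn WW WB BB K] := free.
have tri := crg_gray_triangle free.
have neq a b : gray a b -> a != b by apply: contraTneq => ->; rewrite gi.
have Msym i j : M i j = M j i.
  by rewrite /M /crg_cost eq_sym gs ns; case: eqP => [->|].
have M0 i j : 0 <= M i j by rewrite /M /crg_cost; do ![case: ifP => _]; lra.
have [y [sy ymin ycrit ypos]] := simplex_core sx0 Msym.
apply: le_trans (ymin _ sx0); rewrite leNgt; apply/negP.
set g := quad M y => gp; have [y0 y1] := sy.
have g0 : 0 <= g.
  by apply: sumr_ge0 => i _; apply: sumr_ge0 => j _; rewrite !mulr_ge0.
have p0 : 0 < p by nra.
have supp j : y j != 0 -> 0 < y j by rewrite lt_def y0 andbT.
(* A black pair costs [1 - p], and two diagonal entries add up to at most [2 * (1 - p)] for p <=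
   1/2, so [ypos] rules it out. *)
have nb i j : i != j -> 0 < y i -> 0 < y j -> nblk i j.
  move=> ij yi yj; have := ypos i j ij yi yj.
  rewrite /M /crg_cost (negPf ij) !eqxx.
  case: (boolP (gray i j)) => [/gn //|_]; case: (nblk i j) => //.
  by case: ifP; case: ifP; lra.
pose S i := \sum_(j | gray i j) y j.
have S0 i : 0 <= S i by apply: sumr_ge0.
have row i : 0 < y i -> M i i * y i + p * (1 - y i - S i) = g.
  move=> yi; rewrite /g -(ycrit _ yi) -[X in p * (X - _ - _)]y1 /S [in RHS](bigD1 i) //=.
  rewrite (bigD1 i) //= [\sum_(j | gray i j) _](big_mkcond) /= [X in _ - X](bigD1 i) //= gi.
  rewrite add0r [y i + _]addrC addrK -sumrB big_distrr /=.
  congr (_ + _); apply: eq_bigr => j ji.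
  have [->|/supp yj] := eqVneq (y j) 0; first by rewrite if_same subrr !mulr0.
  rewrite /M /crg_cost eq_sym (negPf ji).
  by case: (boolP (gray i j)) => [_|gij]; rewrite ?nb 1?eq_sym //; ring.
have S_le i : S i <= 1 - y i.
  rewrite -y1 (bigD1 i) //= addrAC subrr add0r /S big_mkcond [leLHS](bigD1 i) //= gi add0r.
  by apply: ler_sum => j _; case: ifP.
have Mii i : M i i = if blk i then 1 - p else p by rewrite /M /crg_cost eqxx.
case: (boolP [exists w, (0 < y w) && ~~ blk w]) => [/existsP [w /andP [yw ww]]|].
  have := row w yw; rewrite Mii (negPf ww) => gw.
  (* Within the support, gray neighbours of the white cell [w] are black, and two of them would be
     joined by a nonblack pair, against [WB]; so there is at most one. *)
  case: (boolP [exists b, (0 < y b) && gray w b]) => [/existsP [b /andP [yb wb]]|].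
    have bb : blk b by apply/negPn/negP => bb; exact: (WW w b).
    have Sw : S w = y b.
      rewrite /S (bigD1 b) //= big1 ?addr0 // => b' /andP [wb' b'b].
      apply/eqP/negPn/negP => /supp yb'; apply: (WB w b b') => //.
      - by apply/negPn/negP => bb'; exact: (WW w b').
      - by rewrite eq_sym.
      - by rewrite nb // eq_sym.
    (* The row of [w] gives [y b > p]; the row of [b] then gives
       [g >= (1 - p) * y b > p * (1 - p)]. *)
    have := row b yb; rewrite Mii bb => gb; have := S_le b; rewrite Sw in gw.
    nra.
  rewrite negb_exists => /forallP nog.
  have Sw : S w = 0.
    apply: big1 => b wb; apply/eqP/negPn/negP => /supp yb.
    by have := nog b; rewrite yb wb.
  by rewrite Sw in gw; nra.
rewrite negb_exists => /forallP allb.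
have black i : 0 < y i -> blk i by have := allb i; case: (blk i) => //; rewrite andbT => /negPf ->.
have [i0 _] := simplex_exists_gt0 sy.
have [v _ vmax] := @arg_maxP _ R C i0 xpredT y isT.
have yv : 0 < y v.
  have [i yi] := simplex_exists_gt0 sy; exact: lt_le_trans (vmax i isT).
have pS i : 0 < y i -> p * S i = (p - g) + (1 - 2 * p) * y i.
  by move=> yi; have := row i yi; rewrite Mii black //; lra.
pose N := [pred j | gray v j && (0 < y j)]; pose d : R := #|N|%:R.
have SvE : S v = \sum_(j in N) y j.
  rewrite /S [RHS](eq_bigl (fun j => gray v j && (0 < y j))) //.
  rewrite [RHS]big_mkcondr /=; apply: eq_bigr => j _; case: ifP => // /negbT.
  by rewrite lt_def y0 andbT negbK => /eqP.
have sumN c : \sum_(j in N) c = d * c by rewrite sumr_const -mulr_natl.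
(* Without gray triangles the gray neighbourhoods of [v] and [j] are disjoint, so [S v + S j <= 1];
   the two row equations turn this into a bound on the weights. *)
have adjle j : gray v j -> 0 < y j -> p < 1 / 2 /\ y v + y j < p.
  move=> vj yj; have le1 : S v + S j <= 1.
    rewrite -y1 /S [\sum_(_ | gray v _) _]big_mkcond [\sum_(_ | gray j _) _]big_mkcond /=.
    rewrite -big_split; apply: ler_sum => k _ /=.
    case: ifP => vk; case: ifP => jk; rewrite ?addr0 ?add0r //.
    by case: (tri v j k).
  have := pS v yv; have := pS j yj => Ej Ev.
  have h : (1 - 2 * p) * (y v + y j) < p * (1 - 2 * p).
    have : p * (S v + S j) <= p by rewrite ger_pMr.
    nra.
  have p12' : p < 1 / 2.
    rewrite ltNge; apply/negP => p12'.
    have pE : 1 - 2 * p = 0 by clear -p12 p12'; lra.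
    by rewrite pE mul0r mulr0 ltxx in h.
  split=> //; move: h; rewrite [X in _ < X]mulrC ltr_pM2l //; lra.
have Sv0 : 0 < S v.
  have := pS v yv; nra.
have [j0 /andP [vj0 yj0]] : exists j, gray v j && (0 < y j).
  apply/existsP; apply: contraT; rewrite negb_exists => /forallP H.
  by move: Sv0; rewrite SvE big1 ?ltxx // => j; rewrite inE (negPf (H j)).
have [p12' _] := adjle _ vj0 yj0; have := adjle _ vj0 yj0 => -[_ ylt].
(* The number of cells of [N] gray to [k] is at most [d] if [k] is [v], is 0 if [k] is gray to [v]
   (triangle), and is at most 2 otherwise, since three would form a K_{2,3} with [v] and [k] as the
   small side. *)
have count k : 0 < y k -> \sum_(j in N) (gray j k)%:R <=
    (k == v)%:R * d + 2 * ((k != v)%:R - (gray v k)%:R) :> R.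
  move=> yk; case: (eqVneq k v) => [->|kv] /=.
    rewrite gi subrr mulr0 addr0 mul1r -[d]mulr1 -sumN.
    by apply: ler_sum => j _; case: (gray j v).
  rewrite mul0r add0r; case: (boolP (gray v k)) => vk.
    rewrite subrr mulr0 big1 // => j; rewrite inE => /andP [vj yj].
    by case: (boolP (gray j k)) => // jk; case: (tri v j k).
  rewrite subr0 mulr1 -natr_sum (ler_nat _ _ 2) leqNgt.
  rewrite -big_mkcondr sum1_card; apply/negP => /card_gt2P [a [b [c [[]]]]].
  rewrite !unfold_in /= => /andP [/andP [va ya] ak] /andP [/andP [vb yb] bk].
  move=> /andP [/andP [vc yc] ck] [ab bc ca].
  apply: (K v k a b c); rewrite ?[gray k _]gs ?va ?vb ?vc ?ak ?bk ?ck //.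
    by rewrite [v == k]eq_sym kv ab bc [a == c]eq_sym ca.
  by rewrite !nb // eq_sym.
have double : \sum_(j in N) S j <= d * y v + 2 * (1 - y v - S v).
  have -> : \sum_(j in N) S j = \sum_k (\sum_(j in N) (gray j k)%:R) * y k.
    under [RHS]eq_bigr do rewrite big_distrl /=.
    rewrite exchange_big; apply: eq_bigr => j _; rewrite /S big_mkcond.
    by apply: eq_bigr => k _; case: ifP; rewrite ?mul1r ?mul0r.
  have -> : d * y v + 2 * (1 - y v - S v) = \sum_k
      ((k == v)%:R * d + 2 * ((k != v)%:R - (gray v k)%:R)) * y k.
    under [RHS]eq_bigr do rewrite mulrDl -!mulrA mulrBl.
    rewrite big_split -big_distrr sumrB /=.
    congr (_ + _ * (_ - _)).
    - rewrite (bigD1 v) //= eqxx mul1r big1 ?addr0 // => k /negPf ->.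
      by rewrite mul0r.
    - rewrite -[X in X - _]y1 (bigD1 v) //= addrAC subrr add0r [RHS](bigD1 v) //= eqxx mul0r add0r.
      by apply: eq_bigr => k ->; rewrite mul1r.
    - rewrite /S big_mkcond; apply: eq_bigr => k _.
      by case: ifP; rewrite ?mul1r ?mul0r.
  apply: ler_sum => k _; have [->|/supp yk] := eqVneq (y k) 0; first by rewrite !mulr0.
  by apply: ler_wpM2r => //; exact: count.
apply: (@black_core_arith R p g (y v) (S v) d) => //.
- by have := y0 j0; lra.
- exact: pS.
- by rewrite SvE -sumN; apply: ler_sum => j _; exact: vmax.
- rewrite SvE -sumN; apply: ler_sum => j; rewrite inE => /andP [vj yj].
  by have [_] := adjle j vj yj; lra.
have -> : d * (p - g) + (1 - 2 * p) * S v = p * \sum_(j in N) S j.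
  rewrite -sumN SvE !big_distrr /= -big_split /=.
  by apply: eq_bigr => j; rewrite inE => /andP [_ yj]; rewrite pS.
by apply: ler_wpM2l; rewrite // ltW.
Qed.

Lemma crg_cost_ge (R : realType) (C : finType) (p : R)
    (blk : pred C) (gray nblk : rel C) (x : C -> R) :
  K23_free_crg blk gray nblk -> 0 <= p <= 1 -> simplex x ->
  Num.min (p * (1 - p)) ((1 - p) / 2) <= quad (crg_cost p blk gray nblk) x.
Proof.
move=> free p01 sx; rewrite ge_min; case: (lerP p (1 / 2)) => p12.
  by rewrite crg_cost_ge_split //; lra.
by rewrite [_ / 2 <= _]crg_cost_ge_half ?orbT //; lra.
Qed.

(** * Counting induced K_{2,3} in regular cells *)

Definition box (V T : finType) (cell : T -> {set V}) : {set {ffun T -> V}} :=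
  [set x : {ffun T -> V} | [forall u, x u \in cell u]]%SET.

Definition upd2 (V T : finType) (x : {ffun T -> V}) (u v : T) (y z : V) :=
  [ffun w => if w == u then y else if w == v then z else x w].

(* Averaging over the box may first redraw the coordinates [u] and [v]. *)
Lemma sum_resample (R : realFieldType) (V T : finType) (cell : T -> {set V})
    (u v : T) (f : {ffun T -> V} -> R) : u != v ->
  (\sum_(x in box cell) f x) * (#|cell u| * #|cell v|)%:R =
  \sum_(x in box cell) \sum_(y in cell u) \sum_(z in cell v) f (upd2 x u v y z).
Proof.
move=> uv.
have -> : (\sum_(x in box cell) f x) * (#|cell u| * #|cell v|)%:R =
    \sum_(x in box cell) \sum_(yz | (yz.1 \in cell u) && (yz.2 \in cell v)) f x.
  rewrite big_distrl /=; apply: eq_bigr => x _.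
  rewrite sumr_const -[f x *+ _]mulr_natr -cardsX; congr (_ * _%:R).
  by apply: eq_card => -[y z]; rewrite finset.in_setX.
under [RHS]eq_bigr do rewrite pair_big /=.
rewrite !pair_big_dep /=.
(* Exchanging the coordinates [u], [v] of the point with the redrawn values is an involution of the
   index set. *)
pose s (t : {ffun T -> V} * (V * V)) := (upd2 t.1 u v t.2.1 t.2.2, (t.1 u, t.1 v)).
have sK : involutive s.
  case=> x [y z]; rewrite /s /= !ffunE !eqxx eq_sym (negPf uv); congr (_, _).
  by apply/ffunP => w; rewrite !ffunE; case: eqP => [->//|_]; case: eqP => [->|].
rewrite (reindex_inj (inv_inj sK)) /=; apply: eq_bigl => -[x [y z]] /=.
rewrite !inE; apply/andP/andP => -[/forallP H /andP [yu zv]]; split.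
- apply/forallP => w; have := H w; rewrite ffunE.
  by case: eqP => [->//|_]; case: eqP => [->//|].
- by have := H u; have := H v; rewrite !ffunE !eqxx eq_sym (negPf uv) => -> ->.
- apply/forallP => w; rewrite ffunE.
  by case: eqP => [->//|_]; case: eqP => [->//|].
- by rewrite !H.
Qed.

(** Fubini in counting form: an estimate valid for every fixing of the other coordinates is averaged
    over the box. *)
Lemma sum_box_ge (R : realFieldType) (V T : finType) (cell : T -> {set V})
    (u v : T) (P : rel V) (h : pred {ffun T -> V}) (d e : R) : u != v ->
  (forall x, x \in box cell ->
     d * (\sum_(y in cell u) \sum_(z in cell v) (h (upd2 x u v y z))%:R)
       - e * (#|cell u| * #|cell v|)%:R <=
     \sum_(y in cell u) \sum_(z in cell v) (h (upd2 x u v y z) && P y z)%:R) ->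
  d * (\sum_(x in box cell) (h x)%:R) - e * #|box cell|%:R <=
  \sum_(x in box cell) (h x && P (x u) (x v))%:R.
Proof.
move=> uv H; have [b0|[x0 x0b]] := set_0Vmem (box cell).
  by rewrite b0 !big_set0 cards0 !mulr0 subr0.
have cu0 : (0 < #|cell u| * #|cell v|)%N.
  move: x0b; rewrite inE => /forallP x0c.
  by rewrite muln_gt0 !card_gt0; apply/andP; split; apply/set0Pn; eexists; apply: x0c.
rewrite -(@ler_pM2r _ (#|cell u| * #|cell v|)%:R) ?ltr0n //.
rewrite mulrBl -mulrA !sum_resample // big_distrr /=.
have -> : e * #|box cell|%:R = \sum_(x in box cell) e.
  by rewrite sumr_const mulr_natr.
rewrite big_distrl -sumrB /=; apply: ler_sum => x xb.
apply: le_trans (H x xb) _; rewrite le_eqVlt; apply/orP; left; apply/eqP.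
by apply: eq_bigr => y _; apply: eq_bigr => z _; rewrite !ffunE !eqxx eq_sym (negPf uv).
Qed.

(** One-sided regularity. As the error refers to the full cells, each condition imposed on a box
    costs at most [e] times the size of the box, whatever was imposed before. *)
Definition dense_below (R : realFieldType) (V : finType) (A0 B0 : {set V})
    (P : rel V) (d e : R) :=
  forall A B : {set V}, A \subset A0 -> B \subset B0 ->
  d * (#|A| * #|B|)%:R - e * (#|A0| * #|B0|)%:R <=
  \sum_(y in A) \sum_(z in B) (P y z)%:R.

(* With all coordinates but [u] and [v] fixed, [h] is the indicator of a
   rectangle, so that cut-type regularity of the pair [u, v] applies to it. *)
Definition separable2 (V T : finType) (u v : T) (h : pred {ffun T -> V}) :=
  forall x, exists al be : pred V,
  forall y z, h (upd2 x u v y z) = al y && be z.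

Lemma sum_rect (R : realFieldType) (V : finType) (S U : {set V})
    (al be : pred V) (P : V -> V -> R) :
  \sum_(y in S) \sum_(z in U) (al y && be z)%:R * P y z =
  \sum_(y in [set y in S | al y]%SET) \sum_(z in [set z in U | be z]%SET) P y z.
Proof.
rewrite [RHS](eq_bigl (fun y => (y \in S) && al y)) => [|y]; last by rewrite inE.
rewrite [RHS]big_mkcondr /=; apply: eq_bigr => y _; case: (al y) => /=.
  rewrite [RHS](eq_bigl (fun z => (z \in U) && be z)) => [|z]; last by rewrite inE.
  rewrite [RHS]big_mkcondr /=; apply: eq_bigr => z _; case: (be z) => /=.
    by rewrite mul1r.
  by rewrite mul0r.
by rewrite big1 // => z _; rewrite mul0r.
Qed.

Lemma sum_sum1 (R : realFieldType) (V : finType) (S U : {set V}) :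
  \sum_(y in S) \sum_(z in U) 1 = (#|S| * #|U|)%:R :> R.
Proof.
rewrite (eq_bigr (fun=> #|U|%:R)) => [|y _]; last by rewrite -sum1_card natr_sum.
by rewrite sumr_const -mulrnA mulnC.
Qed.

Lemma sum_box_ge_separable (R : realFieldType) (V T : finType)
    (cell : T -> {set V}) (u v : T) (P : rel V) (h : pred {ffun T -> V})
    (d e : R) : u != v ->
  dense_below (cell u) (cell v) P d e -> separable2 u v h ->
  d * (\sum_(x in box cell) (h x)%:R) - e * #|box cell|%:R <=
  \sum_(x in box cell) (h x && P (x u) (x v))%:R.
Proof.
move=> uv dP sh; apply: sum_box_ge => // x _; have [al [be hE]] := sh x.
have := dP [set y in cell u | al y]%SET [set z in cell v | be z]%SET.
rewrite !setIdE !finset.subsetIl -!setIdE => /(_ isT isT).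
rewrite -sum_sum1 -!sum_rect.
under eq_bigr do under eq_bigr do rewrite mulr1 -hE.
move=> le1; apply: le_trans le1 _; rewrite le_eqVlt; apply/orP; left; apply/eqP.
apply: eq_bigr => y _; apply: eq_bigr => z _.
by rewrite hE -natrM mulnb.
Qed.

(** Meant for pairs inside a black cell: only the total density is known there, not that of
    rectangles, so [h] has to ignore both coordinates. *)
Lemma sum_box_ge_const (R : realFieldType) (V T : finType)
    (cell : T -> {set V}) (u v : T) (P : rel V) (h : pred {ffun T -> V})
    (d : R) : u != v ->
  d * (#|cell u| * #|cell v|)%:R <=
    \sum_(y in cell u) \sum_(z in cell v) (P y z)%:R ->
  (forall x y z, h (upd2 x u v y z) = h x) ->
  d * (\sum_(x in box cell) (h x)%:R) <=
  \sum_(x in box cell) (h x && P (x u) (x v))%:R.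
Proof.
move=> uv dP hE; rewrite -[leLHS]subr0 -[X in _ - X](mul0r #|box cell|%:R).
apply: sum_box_ge => // x _; rewrite mul0r subr0.
under eq_bigr do under eq_bigr do rewrite hE.
under [leRHS]eq_bigr do under eq_bigr do rewrite hE.
case: (h x) => //=; first by rewrite sum_sum1.
by rewrite !big1 ?mulr0 // => y _; rewrite big1.
Qed.

Definition pairs_hold (V T : finType) (F : T -> T -> rel V) (s : seq (T * T))
    (x : {ffun T -> V}) :=
  all (fun uv => F uv.1 uv.2 (x uv.1) (x uv.2)) s.

Definition avoids_pair (T : eqType) (u v : T) (ab : T * T) :=
  ~~ ((ab.1 \in [:: u; v]) && (ab.2 \in [:: u; v])).

(** A pair not contained in {u, v} misses [u] or [v], so its condition involves only one of the two
    redrawn values. *)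
Lemma separable2_pairs (V T : finType) (F : T -> T -> rel V) (s : seq (T * T))
    (u v : T) : u != v -> all (avoids_pair u v) s ->
  separable2 u v (pairs_hold F s).
Proof.
move=> uv; elim: s => [|[a b] s IH] /=; first by move=> _ x; exists xpredT, xpredT.
move=> /andP [ab /IH sh] x; have [al [be hE]] := sh x.
have [/orP bv|/norP [na nb]] := boolP ((a == v) || (b == v)); last first.
  exists (fun y => F a b (upd2 x u v y (x v) a) (upd2 x u v y (x v) b) && al y), be.
  move=> y z; rewrite /pairs_hold /= -/(pairs_hold F s _) hE andbA.
  by congr (F a b _ _ && _ && _); rewrite !ffunE ?(negPf na) ?(negPf nb).
exists al, (fun z => F a b (upd2 x u v (x u) z a) (upd2 x u v (x u) z b) && be z).
have [na nb] : a != u /\ b != u.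
  move: ab; rewrite /avoids_pair /= !inE negb_and !negb_or.
  by case: bv => /eqP ->; rewrite ?eqxx ?andbF /= ?orbF => /andP [-> _];
    rewrite eq_sym uv.
move=> y z; rewrite /pairs_hold /= -/(pairs_hold F s _) hE andbCA.
by congr (_ && (F a b _ _ && _)); rewrite !ffunE ?(negPf na) ?(negPf nb).
Qed.

(** The counting lemma, one pair at a time: a new pair multiplies the count by [d] and adds one
    error [e], while earlier errors do not grow because [d <= 1]. *)
Lemma pairs_hold_ge (R : realFieldType) (V T : finType) (cell : T -> {set V})
    (F : T -> T -> rel V) (d e : R) (s s' : seq (T * T)) :
  0 <= d <= 1 -> 0 <= e ->
  pairwise (fun uv ab => avoids_pair uv.1 uv.2 ab) (s ++ s') ->
  all (fun uv => uv.1 != uv.2) s ->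
  (forall uv, uv \in s ->
     dense_below (cell uv.1) (cell uv.2) (F uv.1 uv.2) d e) ->
  d ^+ size s * (\sum_(x in box cell) (pairs_hold F s' x)%:R)
    - (size s)%:R * e * #|box cell|%:R <=
  \sum_(x in box cell) (pairs_hold F (s ++ s') x)%:R.
Proof.
move=> d01 e0; elim: s => [|[u v] s IH] /=.
  by move=> _ _ _; rewrite expr0 mul1r !mul0r subr0.
move=> /andP [av pw] /andP [uv ds] dn.
have {IH} := IH pw ds (fun ab abs => dn ab (@mem_behead _ ((u, v) :: s) ab abs)).
have := @sum_box_ge_separable R V T cell u v (F u v) (pairs_hold F (s ++ s')) d e
  uv (dn (u, v) (mem_head _ _)) (separable2_pairs F uv av).
set S := \sum_(x in box cell) (pairs_hold F (s ++ s') x)%:R.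
set S0 := \sum_(x in box cell) (pairs_hold F s' x)%:R.
have -> : \sum_(x in box cell) (pairs_hold F ((u, v) :: s ++ s') x)%:R =
    \sum_(x in box cell) (pairs_hold F (s ++ s') x && F u v (x u) (x v))%:R :> R.
  by apply: eq_bigr => x _; rewrite andbC.
move=> h1 h2; apply: le_trans h1.
have b0 : 0 <= e * #|box cell|%:R :> R by rewrite mulr_ge0 ?ler0n.
have h3 : d * (d ^+ size s * S0 - (size s)%:R * e * #|box cell|%:R) <= d * S.
  by apply: ler_wpM2l => //; case/andP: d01.
have h4 : d * ((size s)%:R * e * #|box cell|%:R) <= (size s)%:R * e * #|box cell|%:R.
  by apply: ler_piMl; rewrite ?mulr_ge0 ?ler0n //; case/andP: d01.
rewrite exprS -natr1; lra.
Qed.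

(** Two coordinates may be drawn from the same cell, so coincidence has to be excluded along with
    adjacency. *)
Definition distinct_nonadj (V : finType) (adj : rel V) : rel V :=
  fun y z => (y != z) && ~~ adj y z.

Local Notation o0 := (@Ordinal 5 0 isT).
Local Notation o1 := (@Ordinal 5 1 isT).
Local Notation o2 := (@Ordinal 5 2 isT).
Local Notation o3 := (@Ordinal 5 3 isT).
Local Notation o4 := (@Ordinal 5 4 isT).

(* [K_{2,3}] on the vertices o0, ..., o4, with sides {o0, o1} and {o2, o3, o4}. *)
Definition K23_constraint (V : finType) (adj : rel V) (u v : 'I_5) : rel V :=
  if (u < 2)%N != (v < 2)%N then adj else distinct_nonadj adj.

Lemma box_gt0 (V T : finType) (cell : T -> {set V}) :
  (forall u, (0 < #|cell u|)%N) -> (0 < #|box cell|)%N.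
Proof.
move=> c0; have ex u : {y | y \in cell u}.
  by apply: sigW; have := c0 u; rewrite card_gt0 => /set0Pn.
apply/card_gt0P; exists [ffun u => sval (ex u)].
by rewrite inE; apply/forallP => u; rewrite ffunE; case: (ex u).
Qed.

Definition pairs5 : seq ('I_5 * 'I_5) :=
  [:: (o0, o1); (o0, o2); (o0, o3); (o0, o4); (o1, o2); (o1, o3);
      (o1, o4); (o2, o3); (o2, o4); (o3, o4)].

(* The pairs in [s] come from regular pairs of cells, those in [s'] from inside
   a cell. *)
Lemma no_K23_pattern (R : realFieldType) (V : finType) (adj : rel V)
    (cell : 'I_5 -> {set V}) (s s' : seq ('I_5 * 'I_5)) (d e c : R) :
  no_K23 adj (fun x y => ~~ adj x y) ->
  0 <= d <= 1 -> 0 <= e -> 0 <= c -> 10 * e < d ^+ 10 * c ->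
  (forall u, (0 < #|cell u|)%N) ->
  all (mem (s ++ s')) pairs5 -> (size s <= 10)%N ->
  pairwise (fun uv ab => avoids_pair uv.1 uv.2 ab) (s ++ s') ->
  all (fun uv => uv.1 != uv.2) s ->
  (forall uv, uv \in s -> dense_below (cell uv.1) (cell uv.2)
     (K23_constraint adj uv.1 uv.2) d e) ->
  c * #|box cell|%:R <=
    \sum_(x in box cell) (pairs_hold (K23_constraint adj) s' x)%:R ->
  False.
Proof.
move=> free d01 e0 c0 ed cell0 /allP cover ss pw ds dn base.
have b0 := box_gt0 cell0; have b0R : 0 < #|box cell|%:R :> R by rewrite ltr0n.
have := pairs_hold_ge d01 e0 pw ds dn.
case: (boolP [exists x in box cell, pairs_hold (K23_constraint adj) (s ++ s') x]).
  move=> /exists_inP [x _ /allP H] _.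
  have {}H uv : uv \in pairs5 ->
      K23_constraint adj uv.1 uv.2 (x uv.1) (x uv.2).
    by move=> /cover; exact: H.
  have /andP [n01 e01] := H (o0, o1) isT; have e02 := H (o0, o2) isT.
  have e03 := H (o0, o3) isT; have e04 := H (o0, o4) isT.
  have e12 := H (o1, o2) isT; have e13 := H (o1, o3) isT.
  have e14 := H (o1, o4) isT; have /andP [n23 e23] := H (o2, o3) isT.
  have /andP [n24 e24] := H (o2, o4) isT; have /andP [n34 e34] := H (o3, o4) isT.
  apply: (free (x o0) (x o1) (x o2) (x o3) (x o4)); first [exact/and4P | exact/and3P].
move=> /exists_inPn H; rewrite [leRHS]big1 => [|x xb]; last by rewrite (negPf (H x xb)).
set S := \sum_(_ in _) _ in base *.
rewrite leNgt => /negP []; rewrite subr_gt0.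
have [d0 d1] := andP d01.
have h1 : d ^+ 10 * (c * #|box cell|%:R) <= d ^+ size s * S.
  apply: ler_pM => //; rewrite ?exprn_ge0 ?mulr_ge0 ?ler0n //.
  exact: ler_wiXn2l.
apply: lt_le_trans h1; rewrite mulrA ltr_pM2r //; apply: le_lt_trans ed.
by apply: ler_wpM2r => //; rewrite (ler_nat R _ 10).
Qed.

(** At density 1 the counting lemma is a union bound: four conditions fail on a share of at most
    [8 * k <= 2 / 5]. The weak conclusion [k ^+ 2] matches the black pattern, whose two inner edges
    cost a factor [k] each. *)
Lemma pairs_hold_white (R : realFieldType) (V : finType) (adj : rel V)
    (cell : 'I_5 -> {set V}) (s : seq ('I_5 * 'I_5)) (k : R) :
  0 <= k -> k <= 1 / 20 ->
  pairwise (fun uv ab => avoids_pair uv.1 uv.2 ab) s ->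
  all (fun uv => uv.1 != uv.2) s -> (size s <= 4)%N ->
  (forall uv, uv \in s -> dense_below (cell uv.1) (cell uv.2)
     (K23_constraint adj uv.1 uv.2) 1 (2 * k)) ->
  k ^+ 2 * #|box cell|%:R <=
    \sum_(x in box cell) (pairs_hold (K23_constraint adj) s x)%:R :> R.
Proof.
move=> k0 k20 pw ds ss dn.
have d01 : 0 <= (1 : R) <= 1 by rewrite ler01 lexx.
have e0 : (0 : R) <= 2 * k by lra.
have := @pairs_hold_ge R V _ cell (K23_constraint adj) 1 (2 * k) s [::] d01 e0.
rewrite cats0 => /(_ pw ds dn); apply: le_trans; rewrite expr1n mul1r.
rewrite (eq_bigr (fun=> 1)) // sumr_const.
have b0 : 0 <= #|box cell|%:R :> R by rewrite ler0n.
have : (size s)%:R <= 4 :> R by rewrite (ler_nat R _ 4).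
set b := #|box cell|%:R in b0 *; set t := (size s)%:R => t4.
have h1 : t * (2 * k) <= 4 * (2 * k) by apply: ler_wpM2r; lra.
have h2 : k ^+ 2 <= 1 - t * (2 * k) by nra.
have := ler_wpM2r b0 h2; lra.
Qed.

(** * Forbidden configurations of regular cells *)

Section ClusterPatterns.

Variables (R : realFieldType) (V : finType) (adj : rel V) (d e k : R).
Hypothesis adj_free : no_K23 adj (fun x y => ~~ adj x y).
Hypothesis d01 : 0 <= d <= 1.
Hypothesis e0 : 0 <= e.
Hypothesis k0 : 0 <= k.
Hypothesis k20 : k <= 1 / 20.
Hypothesis ed : 10 * e < d ^+ 10 * k ^+ 2.

Definition nonblack_pair (A B : {set V}) :=
  dense_below A B (distinct_nonadj adj) d e.
Definition gray_pair (A B : {set V}) :=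
  dense_below A B adj d e /\ nonblack_pair A B.
(** One [k] of the error pays for adjacent pairs, the other for coincident ones. *)
Definition white_cell (A : {set V}) :=
  dense_below A A (distinct_nonadj adj) 1 (2 * k).
Definition black_cell (A : {set V}) :=
  k * (#|A| * #|A|)%:R <= \sum_(y in A) \sum_(z in A) (adj y z)%:R :> R.

Local Ltac by_cases_on_pairs :=
  let uv := fresh in
  move=> uv; rewrite !inE; do ?[case/orP]; move=> /eqP -> //=.

(** The two-vertex side is drawn from [A] and the three-vertex side from [B]. *)
Lemma no_white_white (A B : {set V}) : (0 < #|A|)%N -> (0 < #|B|)%N ->
  white_cell A -> white_cell B -> gray_pair A B -> False.
Proof.
move=> A0 B0 wA wB [gAB nAB].
pose cell (u : 'I_5) := nth finset.set0 [:: A; A; B; B; B] u.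
apply: (@no_K23_pattern R V adj cell
  [:: (o0, o2); (o0, o3); (o0, o4); (o1, o2); (o1, o3); (o1, o4)]
  [:: (o0, o1); (o2, o3); (o2, o4); (o3, o4)] d e (k ^+ 2) adj_free d01 e0 (sqr_ge0 k) ed) => //.
- by case=> -[|[|[|[|[|]]]]].
- by by_cases_on_pairs.
- by apply: (pairs_hold_white k0 k20) => //; by_cases_on_pairs.
Qed.

(** The three-vertex side is drawn from the white cell, and the small side has one vertex in each of
    [B] and [C]. *)
Lemma no_white_black_black (A B C : {set V}) :
  (0 < #|A|)%N -> (0 < #|B|)%N -> (0 < #|C|)%N -> white_cell A ->
  gray_pair B A -> gray_pair C A -> nonblack_pair B C -> False.
Proof.
move=> A0 B0 C0 wA [gBA _] [gCA _] nBC.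
pose cell (u : 'I_5) := nth finset.set0 [:: B; C; A; A; A] u.
apply: (@no_K23_pattern R V adj cell
  [:: (o0, o1); (o0, o2); (o0, o3); (o0, o4); (o1, o2); (o1, o3); (o1, o4)]
  [:: (o2, o3); (o2, o4); (o3, o4)] d e (k ^+ 2) adj_free d01 e0 (sqr_ge0 k) ed) => //.
- by case=> -[|[|[|[|[|]]]]].
- by by_cases_on_pairs.
- by apply: (pairs_hold_white k0 k20) => //; by_cases_on_pairs.
Qed.

(** [A] and [B] each host an edge between the two sides, and [C] hosts the fifth vertex; the two
    inner edges are disjoint, so their densities multiply. *)
Lemma no_black_black_black (A B C : {set V}) :
  (0 < #|A|)%N -> (0 < #|B|)%N -> (0 < #|C|)%N ->
  black_cell A -> black_cell B ->
  gray_pair A B -> gray_pair B A -> gray_pair A C -> gray_pair B C -> False.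
Proof.
move=> A0 B0 C0 bA bB [gAB nAB] [gBA nBA] [gAC nAC] [gBC nBC].
pose cell (u : 'I_5) := nth finset.set0 [:: A; B; A; B; C] u.
apply: (@no_K23_pattern R V adj cell
  [:: (o0, o1); (o0, o3); (o0, o4); (o1, o2); (o1, o4); (o2, o3); (o2, o4); (o3, o4)]
  [:: (o0, o2); (o1, o3)] d e (k ^+ 2) adj_free d01 e0 (sqr_ge0 k) ed) => //.
- by case=> -[|[|[|[|[|]]]]].
- by by_cases_on_pairs.
pose F := K23_constraint adj.
have bA' : k * (#|cell o0| * #|cell o2|)%:R <=
  \sum_(y in cell o0) \sum_(z in cell o2) (F o0 o2 y z)%:R by exact: bA.
have bB' : k * (#|cell o1| * #|cell o3|)%:R <=
  \sum_(y in cell o1) \sum_(z in cell o3) (F o1 o3 y z)%:R by exact: bB.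
have hA := @sum_box_ge_const R V _ cell o0 o2 (F o0 o2) xpredT k isT bA'
  (fun _ _ _ => erefl).
have hB : k * (\sum_(x in box cell) (F o0 o2 (x o0) (x o2))%:R) <=
    \sum_(x in box cell) (F o0 o2 (x o0) (x o2) && F o1 o3 (x o1) (x o3))%:R.
  apply: (@sum_box_ge_const R V _ cell o1 o3 (F o1 o3)
    (fun x => F o0 o2 (x o0) (x o2)) k isT bB').
  by move=> x y z; rewrite !ffunE.
rewrite (eq_bigr (fun x : {ffun 'I_5 -> V} => (F o0 o2 (x o0) (x o2) && F o1 o3 (x o1) (x o3))%:R)).
  move: hA hB; rewrite [\sum_(_ in _) _](eq_bigr (fun=> 1)) // sumr_const /=.
  by move=> hA; apply: le_trans; rewrite expr2 -mulrA ler_wpM2l.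
by move=> x _; rewrite /pairs_hold /= andbT.
Qed.

Lemma no_K23_cells (A A' B B' B'' : {set V}) :
  (forall X, X \in [:: A; A'; B; B'; B''] -> (0 < #|X|)%N) ->
  nonblack_pair A A' -> nonblack_pair B B' -> nonblack_pair B' B'' ->
  nonblack_pair B B'' ->
  gray_pair A B -> gray_pair A B' -> gray_pair A B'' ->
  gray_pair A' B -> gray_pair A' B' -> gray_pair A' B'' -> False.
Proof.
move=> X0 nAA' nBB' nB'B'' nBB'' [? _] [? _] [? _] [? _] [? _] [? _].
pose cell (u : 'I_5) := nth finset.set0 [:: A; A'; B; B'; B''] u.
apply: (@no_K23_pattern R V adj cell
  [:: (o0, o1); (o0, o2); (o0, o3); (o0, o4); (o1, o2); (o1, o3);
      (o1, o4); (o2, o3); (o2, o4); (o3, o4)]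
  [::] d e (k ^+ 2) adj_free d01 e0 (sqr_ge0 k) ed) => //.
- by move=> u; apply: X0; rewrite /cell mem_nth.
- by by_cases_on_pairs.
- by apply: (pairs_hold_white k0 k20).
Qed.

End ClusterPatterns.

(** * Szemeredi regularity *)

Section Regularity.

Variables (R : realType) (V : finType) (adj : rel V).
Implicit Types (C : finType) (A B : {set V}).

Definition cell C (c : V -> C) (i : C) : {set V} := [set x | c x == i]%SET.

Definition edge_sum A B : R := \sum_(x in A) \sum_(y in B) (adj x y)%:R.

Definition area C (c : V -> C) (i j : C) : R := (#|cell c i| * #|cell c j|)%:R.

Definition density C (c : V -> C) (i j : C) : R :=
  edge_sum (cell c i) (cell c j) / area c i j.

(* The error is relative to the whole cells, not to [A] and [B]. *)
Definition regular (e : R) C (c : V -> C) (i j : C) : bool :=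
  [forall A : {set V}, forall B : {set V},
    (A \subset cell c i) && (B \subset cell c j) ==>
    (`|edge_sum A B - density c i j * (#|A| * #|B|)%:R| <= e * area c i j)].

Definition irregularity (e : R) C (c : V -> C) : R :=
  \sum_x \sum_y (~~ regular e c (c x) (c y))%:R.

Definition step C (c : V -> C) (x y : V) : R := density c (c x) (c y).

(** The usual index of a partition, written as the squared L2 norm of a function on pairs of
    vertices. *)
Definition energy C (c : V -> C) : R := \sum_x \sum_y step c x y ^+ 2.

Lemma sum_cells C (c : V -> C) (F : V -> V -> R) :
  \sum_x \sum_y F x y =
  \sum_i \sum_j \sum_(x in cell c i) \sum_(y in cell c j) F x y.
Proof.
rewrite (partition_big c xpredT) //=; apply: eq_bigr => i _.
rewrite exchange_big (partition_big c xpredT) //=; apply: eq_bigr => j _.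
rewrite exchange_big /=; apply: eq_big => [x|x _]; first by rewrite inE.
by apply: eq_bigl => y; rewrite inE.
Qed.

Lemma sum_area A B (t : R) :
  \sum_(x in A) \sum_(y in B) t = t * (#|A| * #|B|)%:R.
Proof.
rewrite -sum_sum1 big_distrr; apply: eq_bigr => x _ /=.
by rewrite big_distrr; apply: eq_bigr => y _ /=; rewrite mulr1.
Qed.

Lemma sum_cells_step C (c : V -> C) (h : C -> C -> R) :
  \sum_x \sum_y h (c x) (c y) = \sum_i \sum_j h i j * area c i j.
Proof.
rewrite (sum_cells c); apply: eq_bigr => i _; apply: eq_bigr => j _.
rewrite -sum_area; apply: eq_bigr => x; rewrite inE => /eqP ->.
by apply: eq_bigr => y; rewrite inE => /eqP ->.
Qed.

Lemma edge_sum_bound A B : 0 <= edge_sum A B <= (#|A| * #|B|)%:R.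
Proof.
rewrite -sum_sum1; apply/andP; split.
  by apply: sumr_ge0 => x _; apply: sumr_ge0 => y _; rewrite ler0n.
by apply: ler_sum => x _; apply: ler_sum => y _; case: (adj x y).
Qed.

Lemma density_area C (c : V -> C) i j :
  density c i j * area c i j = edge_sum (cell c i) (cell c j).
Proof.
have [a0|a0] := eqVneq (area c i j) 0; last by rewrite /density divfK.
have := edge_sum_bound (cell c i) (cell c j); rewrite -/(area c i j) a0 mulr0.
by move=> H; apply/eqP; rewrite eq_le.
Qed.

Lemma density_bound C (c : V -> C) i j : 0 <= density c i j <= 1.
Proof.
have := edge_sum_bound (cell c i) (cell c j); rewrite -/(area c i j) /density.
have [->|a0] := eqVneq (area c i j) 0; first by rewrite invr0 mulr0 lexx ler01.
have {}a0 : 0 < area c i j by rewrite lt_def a0 ler0n.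
by move=> /andP [h1 h2]; rewrite divr_ge0 ?(ltW a0) //= ler_pdivrMr // mul1r.
Qed.

(** [step c] is the conditional expectation of [adj] given the cells: both integrate alike against
    functions of the cells. *)
Lemma step_avg C (c : V -> C) (h : C -> C -> R) :
  \sum_x \sum_y step c x y * h (c x) (c y) =
  \sum_x \sum_y (adj x y)%:R * h (c x) (c y).
Proof.
rewrite (sum_cells_step c (fun i j => density c i j * h i j)) (sum_cells c).
apply: eq_bigr => i _; apply: eq_bigr => j _.
rewrite mulrAC density_area big_distrl; apply: eq_bigr => x.
rewrite inE => /eqP ->; rewrite big_distrl; apply: eq_bigr => y.
by rewrite inE => /eqP ->.
Qed.

Lemma energy_le C (c : V -> C) : energy c <= #|V|%:R ^+ 2.
Proof.
have -> : #|V|%:R ^+ 2 = \sum_(x : V) \sum_(y : V) 1 :> R.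
  rewrite expr2 -natrM -cardsT -sum_sum1.
  apply: eq_big => [x|x _]; first by rewrite inE.
  by apply: eq_bigl => y; rewrite inE.
apply: ler_sum => x _; apply: ler_sum => y _.
have /andP [h0 h1] := density_bound c (c x) (c y).
by rewrite expr_le1.
Qed.

(** Pythagoras: [step c] is the orthogonal projection of [step c'] onto functions of the coarser
    cells. *)
Lemma energy_refine C C' (c : V -> C) (c' : V -> C') (pi : C' -> C) :
  (forall x, c x = pi (c' x)) ->
  energy c' = energy c + \sum_x \sum_y (step c' x y - step c x y) ^+ 2.
Proof.
move=> cE.
have e1 : \sum_x \sum_y step c' x y * step c x y = energy c.
  transitivity (\sum_x \sum_y step c' x y * density c (pi (c' x)) (pi (c' y))).
    by apply: eq_bigr => x _; apply: eq_bigr => y _; rewrite -!cE.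
  rewrite (step_avg c' (fun i j => density c (pi i) (pi j))).
  under eq_bigr do under eq_bigr do rewrite -!cE.
  by rewrite -(step_avg c (density c)).
have -> : energy c + \sum_x \sum_y (step c' x y - step c x y) ^+ 2 =
    energy c' + 2 * (energy c - \sum_x \sum_y step c' x y * step c x y).
  rewrite /energy -sumrB big_distrr -!big_split; apply: eq_bigr => x _ /=.
  rewrite -sumrB big_distrr -!big_split; apply: eq_bigr => y _ /=.
  by ring.
by rewrite e1 subrr mulr0 addr0.
Qed.

(** Cauchy-Schwarz in linearised form, [g^2 >= 2 t g - t^2] with [t = e] or [t = - e], which avoids
    dividing by the size of the rectangle. *)
Lemma sum_sqr_ge A B (g : V -> V -> R) (e a : R) : 0 <= e ->
  (#|A| * #|B|)%:R <= a ->
  e * a <= `|\sum_(x in A) \sum_(y in B) g x y| ->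
  e ^+ 2 * a <= \sum_(x in A) \sum_(y in B) g x y ^+ 2.
Proof.
move=> e0 ABa; set S := \sum_(x in A) _ => eS.
have H t : 2 * t * S - t ^+ 2 * (#|A| * #|B|)%:R <=
    \sum_(x in A) \sum_(y in B) g x y ^+ 2.
  rewrite -sum_area /S big_distrr -sumrB; apply: ler_sum => x _ /=.
  rewrite big_distrr -sumrB; apply: ler_sum => y _ /=.
  by rewrite -subr_ge0; have := sqr_ge0 (g x y - t); lra.
have e2 : e ^+ 2 * (#|A| * #|B|)%:R <= e ^+ 2 * a by rewrite ler_wpM2l ?sqr_ge0.
case: (ger0P S) eS => S0 eS.
  by have := H e; have := ler_wpM2l e0 eS; lra.
by have := H (- e); have := ler_wpM2l e0 eS; lra.
Qed.

Definition witness (e : R) C (c : V -> C) (i j : C) : {set V} * {set V} :=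
  odflt (finset.set0, finset.set0) [pick AB : {set V} * {set V} |
    [&& AB.1 \subset cell c i, AB.2 \subset cell c j &
     e * area c i j <
     `|edge_sum AB.1 AB.2 - density c i j * (#|AB.1| * #|AB.2|)%:R|]].

Lemma witnessP (e : R) C (c : V -> C) (i j : C) : ~~ regular e c i j ->
  let: (A, B) := witness e c i j in
  [/\ A \subset cell c i, B \subset cell c j &
   e * area c i j < `|edge_sum A B - density c i j * (#|A| * #|B|)%:R|].
Proof.
rewrite /witness; case: pickP => [[A B] /= /and3P [] //|H] /negP [].
apply/forallP => A; apply/forallP => B; apply/implyP => /andP [sA sB].
by rewrite leNgt; have := H (A, B); rewrite /= sA sB /= => ->.
Qed.

(** All witness sets are cut out at once: the new label of a vertex is its old cell together with
    the set of witnesses containing it. *)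
Lemma energy_increment (e : R) C (c : V -> C) : 0 <= e ->
  exists C' (c' : V -> C') (pi : C' -> C),
  [/\ forall x, c x = pi (c' x), #|C'| = (#|C| * 2 ^ (#|C| * #|C| * 2))%N &
      energy c + e ^+ 2 * irregularity e c <= energy c'].
Proof.
move=> e0; pose T := (C * {set C * C * bool})%type.
pose wit (t : C * C * bool) :=
  let AB := witness e c t.1.1 t.1.2 in if t.2 then AB.1 else AB.2.
pose c' x : T := (c x, [set t | x \in wit t]%SET).
exists T, c', fst; split=> //.
  by rewrite card_prod -[#|{set _}|]cardsT -powersetT card_powerset cardsT !card_prod card_bool.
rewrite (@energy_refine _ _ c c' fst) // lerD2l.
rewrite /irregularity (sum_cells_step c (fun i j => (~~ regular e c i j)%:R)).
rewrite (sum_cells c) big_distrr; apply: ler_sum => i _ /=.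
rewrite big_distrr; apply: ler_sum => j _ /=.
set G := fun x y => (step c' x y - step c x y) ^+ 2.
have G0 x y : 0 <= G x y by exact: sqr_ge0.
case: (boolP (regular e c i j)) => [_|/witnessP] /=.
  by rewrite mul0r mulr0; apply: sumr_ge0 => x _; apply: sumr_ge0 => y _; exact: G0.
rewrite mul1r; case E: (witness e c i j) => [A B] [sA sB dev].
have inA x : (x \in A) = ((i, j, true) \in (c' x).2) by rewrite inE /wit /= E.
have inB x : (x \in B) = ((i, j, false) \in (c' x).2) by rewrite inE /wit /= E.
apply: (@le_trans _ _ (\sum_(x in A) \sum_(y in B) G x y)).
  apply: sum_sqr_ge => //; first by rewrite /area ler_nat leq_mul ?subset_leq_card.
  apply: (le_trans (ltW dev)).
  rewrite le_eqVlt; apply/orP; left; apply/eqP; congr (`| _ |).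
  under [RHS]eq_bigr do rewrite sumrB.
  rewrite sumrB; congr (_ - _); last first.
    rewrite -sum_area; apply: eq_bigr => x xA; apply: eq_bigr => y yB.
    have := fintype.subsetP sA _ xA; have := fintype.subsetP sB _ yB.
    by rewrite !inE /step => /eqP -> /eqP ->.
  (* [A] and [B] are unions of new cells, so on their product [step c'] has the same sum as
     [adj]. *)
  pose h (s t : T) : R := (((i, j, true) \in s.2) && ((i, j, false) \in t.2))%:R.
  have ind (F : V -> V -> R) : \sum_(x in A) \sum_(y in B) F x y =
      \sum_x \sum_y F x y * h (c' x) (c' y).
    rewrite big_mkcond; apply: eq_bigr => x _ /=; rewrite /h -inA; case: ifP => _ /=.
      rewrite big_mkcond; apply: eq_bigr => y _ /=; rewrite -inB.
      by case: ifP; rewrite ?mulr1 ?mulr0.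
    by rewrite big1 // => y _; rewrite mulr0.
  by rewrite /edge_sum !ind step_avg.
rewrite [leLHS]big_mkcond [leRHS]big_mkcond; apply: ler_sum => x _ /=.
case: ifP => xA; last by case: ifP => // _; apply: sumr_ge0 => y _; exact: G0.
rewrite (fintype.subsetP sA _ xA) [leLHS]big_mkcond [leRHS]big_mkcond.
apply: ler_sum => y _ /=; case: ifP => yB; last by case: ifP => // _; exact: G0.
by rewrite (fintype.subsetP sB _ yB).
Qed.

End Regularity.

Definition tower_step (k : nat) := (k * 2 ^ (k * k * 2))%N.

Lemma regularity (R : realType) (e : R) (m : nat) : 0 < e ->
  exists K : nat, forall (V : finType) (adj : rel V) (c0 : V -> 'I_m),
  exists (C : finType) (c : V -> C) (pi : C -> 'I_m),
  [/\ (#|C| <= K)%N, forall x, c0 x = pi (c x) &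
      irregularity adj e c <= e * #|V|%:R ^+ 2].
Proof.
move=> e0; have e30 : 0 < e ^+ 3 by rewrite exprn_gt0.
(* Each failed round gains [e ^+ 3 * #|V|^2], while the energy never exceeds [#|V|^2]; hence some
   round among the first [N] succeeds. *)
pose N := (Num.truncn (e ^+ 3)^-1).+1; exists (iter N tower_step m).
move=> V adj c0.
have tower_ge k : (k <= tower_step k)%N by rewrite leq_pmulr // expn_gt0.
have tower_mono k l : (k <= l)%N -> (tower_step k <= tower_step l)%N.
  by move=> kl; rewrite leq_mul // leq_exp2l // !leq_mul.
have H t : exists (C : finType) (c : V -> C) (pi : C -> 'I_m),
    [/\ (#|C| <= iter t tower_step m)%N, forall x, c0 x = pi (c x) &
      irregularity adj e c <= e * #|V|%:R ^+ 2 \/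
      t%:R * e ^+ 3 * #|V|%:R ^+ 2 <= energy R adj c].
  elim: t => [|t [C [c [pi [cK cE IH]]]]].
    exists 'I_m, c0, id; split=> //; first by rewrite card_ord.
    right; rewrite !mul0r; apply: sumr_ge0 => x _; apply: sumr_ge0 => y _.
    exact: sqr_ge0.
  have [irr|irr] := lerP (irregularity adj e c) (e * #|V|%:R ^+ 2).
    by exists C, c, pi; split=> //; [exact: leq_trans (tower_ge _)|left].
  case: IH => [|IH]; first by rewrite leNgt irr.
  have [C' [c' [pi' [c'E c'K inc]]]] := energy_increment adj c (ltW e0).
  exists C', c', (pi \o pi'); split=> [|x|]; last right.
  - by rewrite c'K; exact: tower_mono.
  - by rewrite cE c'E.
  apply: le_trans inc; have := ler_wpM2l (sqr_ge0 e) (ltW irr).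
  by rewrite -natr1; lra.
have [C [c [pi [cK cE [irr|en]]]]] := H N; exists C, c, pi; split=> //.
have [V0|V0] := posnP #|V|.
  rewrite V0 expr0n mulr0 /irregularity big1 // => x.
  by have := fintype0 x V0.
have V2 : 0 < #|V|%:R ^+ 2 :> R by rewrite exprn_gt0 ?ltr0n.
have := le_trans en (energy_le R adj c); rewrite ger_pMl // leNgt => /negP [].
rewrite -ltr_pdivrMr // mul1r.
by rewrite /N; apply: truncnS_gt.
Qed.

(** * The reduced graph *)

Section ReducedGraph.

Variables (R : realType) (V C : finType) (adj : rel V) (c : V -> C) (d e : R).
Hypothesis adj_sym : symmetric adj.

Notation es := (edge_sum R adj).
Notation dens := (density R adj c).

Lemma edge_sumC (A B : {set V}) : es A B = es B A.
Proof.
rewrite /edge_sum exchange_big; apply: eq_bigr => x _; apply: eq_bigr => y _.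
by rewrite adj_sym.
Qed.

Lemma densityC i j : dens i j = dens j i.
Proof. by rewrite /density edge_sumC /area mulnC. Qed.

(** From size 20 on, the diagonal is at most 1/20 of the pairs of a cell. *)
Definition small_cell (i : C) := (#|cell c i| < 20)%N.
Definition good_pair (i j : C) := [&& i != j, regular adj e c i j,
  regular adj e c j i, ~~ small_cell i & ~~ small_cell j].
(** Pairs that are not good count as black, and so enter no forbidden pattern. *)
Definition nonblack (i j : C) := good_pair i j && (dens i j <= 1 - d).
Definition gray (i j : C) := nonblack i j && (d <= dens i j).
Definition black (i : C) :=
  1 / 20 * (#|cell c i| * #|cell c i|)%:R <= es (cell c i) (cell c i).

Lemma good_pairC : symmetric good_pair.
Proof.
move=> i j; rewrite /good_pair eq_sym; case: (j != i) => //=.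
by case: regular; case: regular => //=; rewrite andbC.
Qed.

Lemma nonblackC : symmetric nonblack.
Proof. by move=> i j; rewrite /nonblack good_pairC densityC. Qed.

Lemma grayC : symmetric gray.
Proof. by move=> i j; rewrite /gray nonblackC densityC. Qed.

Lemma regularP i j (A B : {set V}) : regular adj e c i j ->
  A \subset cell c i -> B \subset cell c j ->
  `|es A B - dens i j * (#|A| * #|B|)%:R| <= e * area R c i j.
Proof. by move=> /forallP /(_ A) /forallP /(_ B) /implyP H sA sB; rewrite H ?sA. Qed.

Lemma nonblack_nonblack_pair i j : nonblack i j ->
  nonblack_pair adj d e (cell c i) (cell c j).
Proof.
move=> /andP [/and5P [ij rij _ _ _] dj] A B sA sB.
have := regularP rij sA sB; rewrite ler_norml => /andP [_].
have -> : \sum_(y in A) \sum_(z in B) (distinct_nonadj adj y z)%:R =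
    (#|A| * #|B|)%:R - es A B :> R.
  rewrite -sum_sum1 -sumrB; apply: eq_bigr => y yA; rewrite -sumrB.
  apply: eq_bigr => z zB; rewrite /distinct_nonadj.
  have -> : y != z.
    apply: contra ij => /eqP yz; have := fintype.subsetP sA _ yA.
    by have := fintype.subsetP sB _ zB; rewrite !inE -yz => /eqP -> /eqP ->.
  by case: (adj y z); rewrite /= ?subrr ?subr0.
have := ler_wpM2r (ler0n R (#|A| * #|B|)) dj; rewrite /area; lra.
Qed.

Lemma gray_gray_pair i j : gray i j -> gray_pair adj d e (cell c i) (cell c j).
Proof.
move=> /andP [nij dj]; split; last exact: nonblack_nonblack_pair.
move: nij => /andP [/and5P [_ rij _ _ _] _] A B sA sB.
have := regularP rij sA sB; rewrite ler_norml => /andP [+ _].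
have := ler_wpM2r (ler0n R (#|A| * #|B|)) dj; rewrite /area /edge_sum; lra.
Qed.

(** A pair that fails to be distinct and nonadjacent is diagonal or an edge, and each kind has share
    at most 1/20. *)
Lemma white_white_cell i : ~~ small_cell i -> ~~ black i ->
  white_cell adj (1 / 20 : R) (cell c i).
Proof.
rewrite /black -leqNgt -ltNge; set D := cell c i => n20 wi A B sA sB.
have : \sum_(y in A) \sum_(z in B) (1 - (distinct_nonadj adj y z)%:R) <=
    \sum_(y in D) \sum_(z in D) ((y == z)%:R + (adj y z)%:R) :> R.
  rewrite [leLHS]big_mkcond [leRHS]big_mkcond; apply: ler_sum => y _ /=.
  have P0 z : 0 <= (y == z)%:R + (adj y z)%:R :> R by rewrite addr_ge0 ?ler0n.
  case: ifP => yA; last by case: ifP => // _; apply: sumr_ge0 => z _; exact: P0.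
  rewrite (fintype.subsetP sA _ yA) [leLHS]big_mkcond [leRHS]big_mkcond.
  apply: ler_sum => z _ /=; case: ifP => zB; last by case: ifP => // _; exact: P0.
  rewrite (fintype.subsetP sB _ zB) /distinct_nonadj.
  by case: (y == z); case: (adj y z) => /=; rewrite ?subr0 ?subrr ?addr0 ?add0r // lerDl ler01.
under eq_bigr do rewrite sumrB.
rewrite sumrB sum_sum1; under [X in _ <= X]eq_bigr do rewrite big_split.
rewrite big_split /= -/(es D D).
have -> : \sum_(y in D) \sum_(z in D) (y == z)%:R = #|D|%:R :> R.
  rewrite -sum1_card natr_sum; apply: eq_bigr => y yD.
  rewrite (bigD1 y) //= eqxx big1 ?addr0 // => z /andP [_ zy].
  by rewrite eq_sym (negPf zy).
have n20R : 20 <= #|D|%:R :> R by rewrite (ler_nat R 20).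
have : #|D|%:R <= 1 / 20 * (#|D| * #|D|)%:R :> R by rewrite natrM; nra.
move: wi; lra.
Qed.

Lemma gray_big i j : gray i j -> ~~ small_cell i /\ ~~ small_cell j.
Proof. by move=> /andP [/andP [/and5P []]]. Qed.

Lemma big_cell_gt0 i : ~~ small_cell i -> (0 < #|cell c i|)%N.
Proof. by rewrite -leqNgt; apply: leq_trans. Qed.

Lemma reduced_graph_K23_free :
  no_K23 adj (fun x y => ~~ adj x y) -> 0 <= d <= 1 -> 0 <= e ->
  10 * e < d ^+ 10 * (1 / 20) ^+ 2 ->
  K23_free_crg black gray nonblack.
Proof.
move=> free d01 e0 ed.
have k0 : 0 <= 1 / 20 :> R by lra.
have kk : 1 / 20 <= 1 / 20 :> R by [].
split.
- exact: grayC.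
- exact: nonblackC.
- by move=> i; rewrite /gray /nonblack /good_pair eqxx.
- by move=> i j /andP [].
- move=> i j wi wj gij; have [bi bj] := gray_big gij.
  apply: (no_white_white free d01 e0 k0 kk ed (A := cell c i) (B := cell c j)).
  + exact: big_cell_gt0.
  + exact: big_cell_gt0.
  + exact: white_white_cell.
  + exact: white_white_cell.
  + exact: gray_gray_pair.
- move=> i j k wi _ _ _ gij gik njk.
  have [bi bj] := gray_big gij; have [_ bk] := gray_big gik.
  rewrite grayC in gij; rewrite grayC in gik.
  apply: (no_white_black_black free d01 e0 k0 kk ed
    (A := cell c i) (B := cell c j) (C := cell c k)).
  + exact: big_cell_gt0.
  + exact: big_cell_gt0.
  + exact: big_cell_gt0.
  + exact: white_white_cell.
  + exact: gray_gray_pair.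
  + exact: gray_gray_pair.
  + exact: nonblack_nonblack_pair.
- move=> i j k bi bj _ gij gik gjk.
  have [gi gj] := gray_big gij; have [_ gk] := gray_big gik.
  apply: (no_black_black_black free d01 e0 k0 ed
    (A := cell c i) (B := cell c j) (C := cell c k)).
  + exact: big_cell_gt0.
  + exact: big_cell_gt0.
  + exact: big_cell_gt0.
  + exact: bi.
  + exact: bj.
  + exact: gray_gray_pair.
  + by apply: gray_gray_pair; rewrite grayC.
  + exact: gray_gray_pair.
  + exact: gray_gray_pair.
move=> a a' b b' b'' _ /and4P [n1 n2 n3 n4] /and3P [g1 g2 g3] /and3P [g4 g5 g6].
apply: (no_K23_cells free d01 e0 k0 kk ed (A := cell c a) (A' := cell c a')
  (B := cell c b) (B' := cell c b') (B'' := cell c b'')).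
- move=> X; have [ga gb] := gray_big g1; have [ga' gb'] := gray_big g5.
  have [_ gb''] := gray_big g3.
  by rewrite !inE => /or4P [| | |/orP []] /eqP ->; exact: big_cell_gt0.
- exact: nonblack_nonblack_pair.
- exact: nonblack_nonblack_pair.
- exact: nonblack_nonblack_pair.
- exact: nonblack_nonblack_pair.
- exact: gray_gray_pair.
- exact: gray_gray_pair.
- exact: gray_gray_pair.
- exact: gray_gray_pair.
- exact: gray_gray_pair.
- exact: gray_gray_pair.
Qed.

End ReducedGraph.

(** * From the quadratic form to the number of edits *)

Lemma sum_card_cell (V C : finType) (c : V -> C) :
  (\sum_i #|cell c i|)%N = #|V|.
Proof.
rewrite -sum1_card (partition_big c xpredT) //=.
by apply: eq_bigr => i _; rewrite -sum1_card; apply: eq_bigl => x; rewrite inE.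
Qed.

Lemma cell_simplex (R : realType) (V C : finType) (c : V -> C) :
  (0 < #|V|)%N -> simplex (fun i => #|cell c i|%:R / #|V|%:R : R).
Proof.
move=> V0; split=> [i|]; first by rewrite divr_ge0 ?ler0n.
by rewrite -big_distrl -natr_sum sum_card_cell /= divff // pnatr_eq0 -lt0n.
Qed.

Lemma sum_area_small (R : realType) (V C : finType) (c : V -> C) :
  \sum_i \sum_j (small_cell c i)%:R * area R c i j <= 20 * #|C|%:R * #|V|%:R.
Proof.
have -> : 20 * #|C|%:R * #|V|%:R = \sum_(i : C) 20 * #|V|%:R :> R.
  by rewrite sumr_const -[RHS]mulr_natr mulrAC.
apply: ler_sum => i _; rewrite -big_distrr /= /area.
have -> : \sum_j (#|cell c i| * #|cell c j|)%:R = #|cell c i|%:R * #|V|%:R :> R.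
  by rewrite -natr_sum -big_distrr /= sum_card_cell natrM.
rewrite mulrA ler_wpM2r ?ler0n // /small_cell; case: ltnP => h.
  by rewrite mul1r (ler_nat R _ 20) ltnW.
by rewrite mul0r.
Qed.

(** Sources of the error terms: [d] from the colour thresholds, [2 * I] from regularity in both
    orders, [D] from pairs inside cells, 40 from small cells on either side, and [eta] once per pair
    of cells. All sums run over ordered pairs. *)
Lemma edit_cost_ge (R : realType) (V C : finType) (adj a : rel V) (c : V -> C)
    (p d e eta I D : R) :
  symmetric adj -> no_K23 adj (fun x y => ~~ adj x y) ->
  0 <= p <= 1 -> 0 <= d <= 1 -> 0 <= e ->
  10 * e < d ^+ 10 * (1 / 20) ^+ 2 -> (0 < #|V|)%N ->
  (forall A B : {set V}, `|edge_sum R a A B - p * (#|A| * #|B|)%:R| <= eta) ->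
  irregularity adj e c <= I ->
  \sum_x \sum_y (c x == c y)%:R <= D ->
  Num.min (p * (1 - p)) ((1 - p) / 2) * #|V|%:R ^+ 2 <=
  \sum_x \sum_y (a x y != adj x y)%:R + d * #|V|%:R ^+ 2 + 2 * I + D
    + 40 * #|C|%:R * #|V|%:R + #|C|%:R ^+ 2 * eta.
Proof.
move=> adj_sym free p01 d01 e0 ed V0 qr irr diag.
have eta0 : 0 <= eta by apply: le_trans (qr finset.set0 finset.set0); exact: normr_ge0.
have crg := @reduced_graph_K23_free R V C adj c d e adj_sym free d01 e0 ed.
have := crg_cost_ge crg p01 (cell_simplex R c V0).
set M := crg_cost _ _ _ _; set N := #|V|%:R : R.
have N0 : 0 < N by rewrite ltr0n.
have -> : quad M (fun i => #|cell c i|%:R / N) =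
    (\sum_i \sum_j M i j * area R c i j) / N ^+ 2.
  rewrite big_distrl; apply: eq_bigr => i _; rewrite big_distrl.
  apply: eq_bigr => j _ /=; rewrite /area natrM; field.
  by rewrite gt_eqF.
rewrite ler_pdivlMr ?exprn_gt0 // => H; apply: le_trans H _.
pose bad i j : R := (i == j)%:R + (~~ regular adj e c i j)%:R +
  (~~ regular adj e c j i)%:R + (small_cell c i)%:R + (small_cell c j)%:R.
pose E i j : R := \sum_(x in cell c i) \sum_(y in cell c j) (a x y != adj x y)%:R.
have area0 i j : 0 <= area R c i j by rewrite ler0n.
have E0 i j : 0 <= E i j by apply: sumr_ge0 => x _; apply: sumr_ge0 => y _; rewrite ler0n.
have bad0 i j : 0 <= bad i j by rewrite !addr_ge0 ?ler0n.
have EE i j : `|edge_sum R adj (cell c i) (cell c j) -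
    edge_sum R a (cell c i) (cell c j)| <= E i j.
  rewrite /edge_sum -sumrB; apply: le_trans (ler_norm_sum _ _ _) _.
  apply: ler_sum => x _; rewrite -sumrB; apply: le_trans (ler_norm_sum _ _ _) _.
  apply: ler_sum => y _; case: (a x y); case: (adj x y) => /=.
  - by rewrite subrr normr0.
  - by rewrite sub0r normrN normr1.
  - by rewrite subr0 normr1.
  - by rewrite subrr normr0.
have pair i j : M i j * area R c i j <=
    E i j + d * area R c i j + bad i j * area R c i j + eta.
  have A0 := area0 i j; have Eij := E0 i j.
  have [d0 d1] := andP d01.
  have dA0 : 0 <= d * area R c i j by rewrite mulr_ge0.
  (* A bad pair, in particular a diagonal one, pays its whole cost, at most 1, through [bad]. *)
  have [g|ng] := boolP (good_pair adj c e i j); last first.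
    have M1 : M i j <= 1.
      by rewrite /M /crg_cost; do ![case: ifP => _]; lra.
    have b1 : 1 <= bad i j.
      move: ng; rewrite /good_pair /bad; case: (i == j) => /=.
        by rewrite -!addrA lerDl !addr_ge0 ?ler0n.
      case: regular => /=; last by rewrite add0r -!addrA lerDl !addr_ge0 ?ler0n.
      case: regular => /=; last by rewrite !add0r -!addrA lerDl !addr_ge0 ?ler0n.
      case: small_cell => /=; first by rewrite !add0r lerDl ler0n.
      by case: small_cell => //=; rewrite !add0r.
    have := ler_wpM2r A0 M1; have := ler_wpM2r A0 b1; lra.
  have dev : `|density R adj c i j - p| * area R c i j <= E i j + eta.
    rewrite -[X in _ * X]ger0_norm // -normrM mulrBl density_area.
    have := qr (cell c i) (cell c j); have := EE i j; rewrite -/(area R c i j).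
    move=> h1 h2; apply: le_trans (lerD h1 h2); apply: le_trans (ler_normD _ _).
    by rewrite addrA subrK.
  have bA0 : 0 <= bad i j * area R c i j by rewrite mulr_ge0.
  (* White costs [p] at density below [d], black costs [1 - p] at density above [1 - d], and gray is
     free. *)
  have Md : M i j <= `|density R adj c i j - p| + d.
    rewrite /M /crg_cost; move: (g) => /and5P [/negPf -> _ _ _ _].
    have nn := normr_ge0 (density R adj c i j - p).
    rewrite /gray /nonblack g /=; case: (lerP (density R adj c i j) (1 - d)) => /= h1.
      case: (lerP d (density R adj c i j)) => /= h2; first by rewrite addr_ge0.
      by have := ler_norm (- (density R adj c i j - p)); rewrite normrN; lra.
    by have := ler_norm (density R adj c i j - p); lra.
  have := ler_wpM2r A0 Md; lra.
have sum_pair : \sum_i \sum_j M i j * area R c i j <=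
    \sum_i \sum_j (E i j + d * area R c i j + bad i j * area R c i j + eta).
  by apply: ler_sum => i _; apply: ler_sum => j _.
apply: le_trans sum_pair _.
under eq_bigr do rewrite !big_split /=.
rewrite !big_split /= -(sum_cells c (fun x y => (a x y != adj x y)%:R)).
have -> : \sum_i \sum_j d * area R c i j = d * N ^+ 2.
  under eq_bigr do rewrite -big_distrr /= /area -natr_sum -big_distrr /= sum_card_cell.
  by rewrite -big_distrr -natr_sum -big_distrl /= sum_card_cell expr2 natrM.
have -> : \sum_(i : C) \sum_(j : C) eta = #|C|%:R ^+ 2 * eta.
  by under eq_bigr do rewrite sumr_const; rewrite sumr_const -mulrnA -[LHS]mulr_natl natrM expr2.
suff : \sum_i \sum_j bad i j * area R c i j <= 2 * I + D + 40 * #|C|%:R * N by lra.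
rewrite /bad; under eq_bigr do under eq_bigr do rewrite !mulrDl.
under eq_bigr do rewrite !big_split /=.
rewrite !big_split /=.
have -> : \sum_i \sum_j (i == j)%:R * area R c i j = \sum_x \sum_y (c x == c y)%:R.
  by rewrite (sum_cells_step c (fun i j => (i == j)%:R)).
have i1 : \sum_i \sum_j (~~ regular adj e c i j)%:R * area R c i j <= I.
  by rewrite -(sum_cells_step c (fun i j => (~~ regular adj e c i j)%:R)).
have i2 : \sum_i \sum_j (~~ regular adj e c j i)%:R * area R c i j <= I.
  apply: le_trans i1; rewrite exchange_big le_eqVlt; apply/orP; left; apply/eqP.
  by apply: eq_bigr => i _; apply: eq_bigr => j _; rewrite /area mulnC.
have s1 := sum_area_small R c.
have s2 : \sum_i \sum_j (small_cell c j)%:R * area R c i j <= 20 * #|C|%:R * N.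
  apply: le_trans s1; rewrite exchange_big le_eqVlt; apply/orP; left; apply/eqP.
  by apply: eq_bigr => i _; apply: eq_bigr => j _; rewrite /area mulnC.
rewrite -/N in s1; lra.
Qed.

(** * Quasirandom graphs *)

Section AffinePlaneGraph.

Variables (R : realFieldType) (F : finFieldType) (S : {set F}).

(** For S = {0} this says that the point [y] lies on the line of slope [- x.1] and intercept
    [- x.2]; a larger [S] tunes the density to [#|S| / q]. *)
Definition plane_rel (x y : F * F) := x.1 * y.1 + x.2 + y.2 \in S.

Let q : R := #|F|%:R.
Let xi (x y : F * F) : R := (plane_rel x y)%:R - #|S|%:R / q.

Lemma plane_relC : symmetric plane_rel.
Proof. by move=> x y; rewrite /plane_rel mulrC addrAC. Qed.

Let q0 : 0 < q.
Proof. by rewrite ltr0n; apply/card_gt0P; exists 0. Qed.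

Let xi_le1 x y : `|xi x y| <= 1.
Proof.
have s0 : 0 <= #|S|%:R / q by rewrite divr_ge0 ?ler0n.
have s1 : #|S|%:R / q <= 1.
  by rewrite ler_pdivrMr // mul1r ler_nat max_card.
by rewrite /xi ler_norml; case: plane_rel => /=; lra.
Qed.

(* For [x.1 != x'.1] the two arguments tested for membership in [S] are
   jointly uniform on [F * F] as [y] varies. *)
Lemma plane_codegree x x' : x.1 != x'.1 -> \sum_y xi x y * xi x' y = 0.
Proof.
move=> xx'; pose phi s : R := (s \in S)%:R - #|S|%:R / q.
pose g (y : F * F) := (x.1 * y.1 + x.2 + y.2, x'.1 * y.1 + x'.2 + y.2).
have g_inj : injective g.
  move=> [u v] [u' v'] [/= e1 e2].
  have uu' : u = u'.
    apply: (@mulfI _ (x.1 - x'.1)); first by rewrite subr_eq0.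
    have : x.1 * u + x.2 + v - (x'.1 * u + x'.2 + v) =
           x.1 * u' + x.2 + v' - (x'.1 * u' + x'.2 + v') by rewrite e1 e2.
    move=> e; have : (x.1 - x'.1) * u + (x.2 - x'.2) = (x.1 - x'.1) * u' + (x.2 - x'.2).
      by transitivity (x.1 * u + x.2 + v - (x'.1 * u + x'.2 + v)); [ring|rewrite e; ring].
    exact: addIr.
  by move: e1; rewrite uu' => /addrI ->.
transitivity (\sum_(y : F * F) phi (g y).1 * phi (g y).2); first by [].
have <- : \sum_st phi st.1 * phi st.2 = \sum_y phi (g y).1 * phi (g y).2.
  by rewrite (reindex_inj g_inj).
rewrite -(pair_big xpredT xpredT (fun s t => phi s * phi t)) /=.
under eq_bigr do rewrite -big_distrr /=.
have -> : \sum_t phi t = 0.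
  rewrite /phi sumrB sumr_const -[X in _ - X]mulr_natr divfK ?gt_eqF //.
  by rewrite -natr_sum -big_mkcond sum1_card subrr.
by rewrite big1 // => s _; rewrite mulr0.
Qed.

Lemma sqr_sum_le (T : finType) (B : {set T}) (g : T -> R) :
  (\sum_(y in B) g y) ^+ 2 <= #|B|%:R * \sum_(y in B) g y ^+ 2.
Proof.
have [->|/set0Pn [b bB]] := eqVneq B finset.set0.
  by rewrite !big_set0 expr0n mulr0.
have B0 : 0 < #|B|%:R :> R by rewrite ltr0n; apply/card_gt0P; exists b.
set s := \sum_(y in B) g y.
have : 0 <= \sum_(y in B) (g y - s / #|B|%:R) ^+ 2 by apply: sumr_ge0 => y _; exact: sqr_ge0.
have -> : \sum_(y in B) (g y - s / #|B|%:R) ^+ 2 =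
    \sum_(y in B) g y ^+ 2 - 2 * (s / #|B|%:R) * s + \sum_(y in B) (s / #|B|%:R) ^+ 2.
  rewrite {3}/s big_distrr -sumrB -big_split /=.
  by apply: eq_bigr => y _; ring.
rewrite sumr_const -[X in _ + X]mulr_natr => H.
have := mulr_ge0 (ltW B0) H.
have -> : #|B|%:R * (\sum_(y in B) g y ^+ 2 - 2 * (s / #|B|%:R) * s +
    (s / #|B|%:R) ^+ 2 * #|B|%:R) = #|B|%:R * (\sum_(y in B) g y ^+ 2) - s ^+ 2.
  by field; rewrite gt_eqF.
by rewrite subr_ge0.
Qed.

(** After Cauchy-Schwarz over [B], [plane_codegree] leaves only pairs with equal first coordinates:
    [q^3] pairs, each contributing at most [q^2]. This saves one factor [q] over the trivial bound
    [q^8]. *)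
Lemma plane_discrepancy (A B : {set F * F}) :
  (\sum_(x in A) \sum_(y in B) xi x y) ^+ 2 <= q ^+ 7.
Proof.
rewrite exchange_big; apply: le_trans (sqr_sum_le _ _) _ => /=.
have sq2 : #|{: F * F}|%:R = q ^+ 2 :> R by rewrite card_prod natrM expr2.
have B2 : #|B|%:R <= q ^+ 2 by rewrite -sq2 ler_nat max_card.
have G0 y : 0 <= (\sum_(x in A) xi x y) ^+ 2 by exact: sqr_ge0.
have le1 : \sum_(y in B) (\sum_(x in A) xi x y) ^+ 2 <= q ^+ 5.
  apply: (@le_trans _ _ (\sum_y (\sum_(x in A) xi x y) ^+ 2)).
    by rewrite big_mkcond; apply: ler_sum => y _; case: ifP.
  have -> : \sum_y (\sum_(x in A) xi x y) ^+ 2 =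
      \sum_(x in A) \sum_(x' in A) \sum_y xi x y * xi x' y.
    under eq_bigr do rewrite expr2 big_distrl /=.
    rewrite exchange_big; apply: eq_bigr => x _ /=.
    under eq_bigr do rewrite big_distrr /=.
    by rewrite exchange_big.
  apply: (@le_trans _ _ (\sum_x \sum_(x' : F * F) (x.1 == x'.1)%:R * q ^+ 2)).
    rewrite [leLHS]big_mkcond; apply: ler_sum => x _ /=.
    have P0 x' : 0 <= (x.1 == x'.1)%:R * q ^+ 2 by rewrite mulr_ge0 ?ler0n ?exprn_ge0 // ltW.
    case: ifP => _; last by apply: sumr_ge0.
    rewrite [leLHS]big_mkcond; apply: ler_sum => x' _ /=; case: ifP => // _.
    have [_|ne] := eqVneq x.1 x'.1; last by rewrite plane_codegree // mul0r.
    rewrite mul1r -sq2 -sum1_card natr_sum; apply: ler_sum => y _.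
    apply: le_trans (ler_norm _) _; rewrite normrM.
    by have := xi_le1 x y; have := xi_le1 x' y => h1 h2; rewrite mulr_ile1.
  have inner (x : F * F) : \sum_(x' : F * F) (x.1 == x'.1)%:R * q ^+ 2 = q ^+ 3.
    rewrite -big_distrl /= -(pair_big xpredT xpredT (fun s (t : F) => (x.1 == s)%:R : R)) /=.
    rewrite (bigD1 x.1) //= eqxx sumr_const big1 ?addr0 => [|s].
      by rewrite -/q -exprS.
    by rewrite eq_sym => /negPf ->; rewrite big1.
  by under eq_bigr do rewrite inner; rewrite sumr_const -[X in X <= _]mulr_natr sq2 -exprD.
have := ler_pM (ler0n R #|B|) _ B2 le1; rewrite -exprD; apply.
by apply: sumr_ge0.
Qed.

End AffinePlaneGraph.

(** * Counting and adjusting edges *)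

Lemma adj_sym (V : finType) (G : graph V) : symmetric (adj G).
Proof. by move=> x y; rewrite /adj finset.setUC. Qed.

Lemma adj_irr (V : finType) (G : graph V) : irreflexive (adj G).
Proof.
move=> x; apply/negP => H; have := forall_inP (edges_card2 G) _ H.
by rewrite cards2 eqxx.
Qed.

Lemma sum_pairs_edges (V : finType) (E : {set {set V}}) :
  (forall e, e \in E -> #|e| = 2%N) ->
  (\sum_x \sum_y ([set x; y]%SET \in E) = 2 * #|E|)%N.
Proof.
move=> E2; rewrite pair_bigA /= -big_mkcond /=.
rewrite (partition_big (fun xy : V * V => [set xy.1; xy.2]%SET) (mem E)) //=.
rewrite mulnC -sum_nat_const; apply: eq_bigr => e eE.
have /cards2P [u [v [uv ee]]] : #|e| == 2%N by rewrite E2.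
rewrite sum1_card (_ : 2%N = #|[set (u, v); (v, u)]%SET|); last first.
  by rewrite cards2 xpair_eqE (negPf uv).
apply: eq_card => -[x y]; rewrite !inE unfold_in /= !xpair_eqE.
apply/andP/orP => [[_ /eqP xyE]|H].
  have xe : x \in e by rewrite -xyE !inE eqxx.
  have ye : y \in e by rewrite -xyE !inE eqxx orbT.
  have xy : x != y.
    by apply/eqP => xy; have := E2 e eE; rewrite -xyE xy cards2 eqxx.
  move: xe ye; rewrite ee !inE => /orP [] /eqP xE /orP [] /eqP yE;
    rewrite xE yE ?eqxx in xy *; by [|left|right].
have -> : [set x; y]%SET = e.
  by rewrite ee; case: H => /andP [/eqP -> /eqP ->] //; rewrite finset.setUC.
by rewrite eqxx.
Qed.

Lemma sum_adj (R : realFieldType) (V : finType) (G : graph V) :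
  \sum_x \sum_y (adj G x y)%:R = 2 * #|edges G|%:R :> R.
Proof.
rewrite -[2 * _]natrM -sum_pairs_edges => [|e eG]; last first.
  exact/eqP/(forall_inP (edges_card2 G)).
by rewrite natr_sum; apply: eq_bigr => x _; rewrite natr_sum.
Qed.

Lemma sum_dist (R : realFieldType) (V : finType) (G G' : graph V) :
  \sum_x \sum_y (adj G x y != adj G' x y)%:R = 2 * (dist G G')%:R :> R.
Proof.
rewrite -[2 * _]natrM -sum_pairs_edges => [|e]; last first.
  rewrite !inE => /orP [] /andP [_ eG]; exact/eqP/(forall_inP (edges_card2 _) _ eG).
rewrite natr_sum; apply: eq_bigr => x _; rewrite natr_sum; apply: eq_bigr => y _.
by rewrite !inE /adj; do ![case: (_ \in _)].
Qed.

Lemma exists_subset_between (T : finType) (A B : {set T}) (t : nat) :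
  A \subset B -> (#|A| <= t <= #|B|)%N ->
  exists2 E : {set T}, A \subset E /\ E \subset B & #|E| = t.
Proof.
move=> AB /andP []; elim: t => [|t IH] At tB.
  by exists A => //; apply/eqP; rewrite -leqn0.
move: At; rewrite leq_eqVlt => /orP [/eqP <-|At]; first by exists A.
have [E [AE EB] Et] := IH At (ltnW tB).
have /properP [_ [x xB xE]] : E \proper B.
  by rewrite properEcard EB Et.
exists (x |: E)%SET; last by rewrite cardsU1 xE Et.
split; first exact: fintype.subset_trans AE (finset.subsetUr _ _).
by rewrite finset.subUset EB andbT finset.sub1set.
Qed.

(** One of the two truncated differences is 0, so their sum is the distance from [t] to [#|A|]. *)
Lemma exists_subset_near (T : finType) (A U : {set T}) (t : nat) :
  A \subset U -> (t <= #|U|)%N ->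
  exists2 E : {set T}, E \subset U /\ #|E| = t &
    (#|(A :\: E) :|: (E :\: A)|%SET = (t - #|A|) + (#|A| - t))%N.
Proof.
move=> AU tU; case: (leqP #|A| t) => At.
  have [|E [AE EU] Et] := @exists_subset_between T A U t AU; first by rewrite At.
  exists E => //; have -> : (A :\: E = finset.set0)%SET by apply/eqP; rewrite finset.setD_eq0.
  rewrite finset.set0U cardsD (finset.setIidPr AE) Et.
  by move/eqP: At => ->; rewrite addn0.
have [||E [_ EA] Et] := @exists_subset_between T finset.set0 A t.
- exact: finset.sub0set.
- by rewrite cards0 leq0n ltnW.
exists E; first by split=> //; exact: fintype.subset_trans EA AU.
have -> : (E :\: A = finset.set0)%SET by apply/eqP; rewrite finset.setD_eq0.
rewrite finset.setU0 cardsD (finset.setIidPr EA) Et.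
by move/ltnW/eqP: At => ->.
Qed.

Lemma graph_adjust (V : finType) (G : graph V) (t : nat) : (t <= 'C(#|V|, 2))%N ->
  exists2 G' : graph V, #|edges G'| = t &
    dist G G' = ((t - #|edges G|) + (#|edges G| - t))%N.
Proof.
move=> tV; pose U := [set e : {set V} | #|e| == 2%N]%SET.
have [||E [EU Et] dE] := @exists_subset_near _ (edges G) U t.
- by apply/fintype.subsetP => e /(forall_inP (edges_card2 G)); rewrite inE.
- by rewrite card_draws.
have E2 : [forall e in E, #|e| == 2%N].
  by apply/forall_inP => e /(fintype.subsetP EU); rewrite inE.
by exists (Graph E2).
Qed.

Lemma graph_of_rel (V : finType) (r : rel V) : symmetric r ->
  exists G : graph V, forall x y, adj G x y = (x != y) && r x y.
Proof.
move=> rs; pose E := [set [set xy.1; xy.2]%SET | xy : V * V & (xy.1 != xy.2) && r xy.1 xy.2]%SET.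
have E2 : [forall e in E, #|e| == 2%N].
  by apply/forall_inP => e /imsetP [[x y]]; rewrite inE /= => /andP [xy _] ->; rewrite cards2 xy.
exists (Graph E2) => x y; rewrite /adj /=; apply/imsetP/idP.
  move=> [[u v]]; rewrite inE /= => /andP [uv ruv] e.
  have : x \in [set u; v]%SET by rewrite -e !inE eqxx.
  have : y \in [set u; v]%SET by rewrite -e !inE eqxx orbT.
  have xy : x != y.
    by apply/negP => /eqP xy; have := cards2 u v; rewrite -e xy cards2 eqxx uv.
  rewrite !inE => /orP [] /eqP yE /orP [] /eqP xE; move: xy; rewrite xE yE ?eqxx //.
    by rewrite rs ruv andbT.
  by rewrite ruv andbT.
by move=> xy; exists (x, y); rewrite ?inE.
Qed.

Lemma double_bin2 (R : realFieldType) (n : nat) :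
  2 * 'C(n, 2)%:R = n%:R ^+ 2 - n%:R :> R.
Proof.
rewrite -natrM -(mul_bin_diag n 1) bin1; case: n => [|n].
  by rewrite mul0n expr0n subrr.
by rewrite natrM -natr1 /=; ring.
Qed.

Lemma quasirandom_graph (R : realType) (p eta : R) : 0 <= p <= 1 -> 0 < eta ->
  exists n0 : nat, forall n, (n0 <= n)%N -> exists G : graph 'I_n,
    #|edges G|%:Z = Num.floor (p * 'C(n, 2)%:R) /\
    forall A B : {set 'I_n},
      `|edge_sum R (adj G) A B - p * (#|A| * #|B|)%:R| <= eta * n%:R ^+ 2.
Proof.
(* Discrepancy, rounding of the density and the diagonal cost [th] each; correcting the edge count
   moves at most [3 * th * n^2] edges, each seen in two orders: 3 + 6 = 9. *)
move=> /andP [p0 p1] eta0; pose th := eta / 9; have th0 : 0 < th by rewrite divr_gt0.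
(* The terms of [Y] ensure [256 <= th ^+ 2 * q], [1 <= th * q] with [1 <= th * N], and [X > 1]; 256
   is [4 ^ 4], from [q ^+ 8 <= (4 * N) ^+ 4]. *)
pose Y := 256 / th ^+ 2 + 1 / th + 1; pose X := (Num.truncn Y).+1.
have XY : Y < X%:R by exact: truncnS_gt.
have a0 : 0 < 256 / th ^+ 2 by rewrite divr_gt0 ?exprn_gt0 ?ltr0n.
have b0 : 0 < 1 / th by rewrite divr_gt0.
exists (X ^ 2)%N => n Xn.
have X2 : (1 < X)%N by rewrite -(ltr_nat R); rewrite /Y in XY; lra.
have Xle : (X <= X ^ 2)%N by rewrite -{1}[X]expn1 leq_exp2l.
have n1 : (1 < n)%N by exact: leq_trans X2 (leq_trans Xle Xn).
(* [4 ^ k] is the least power of 4 reaching [n]; a field of order [2 ^ k] then has a plane with at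
   least [n] and at most [4 * n] points. *)
pose k := up_log 4 n.
have k0 : (0 < k)%N by rewrite up_log_gt0 // n1.
have /andP [nlo nhi] := up_log_bounds (isT : 1 < 4)%N n1.
have [F _ qE] := PrimePowerField (isT : prime 2) k0.
have q2 : (#|F| ^ 2 = 4 ^ k)%N by rewrite qE -expnM mulnC expnM.
have q2n : (#|F| ^ 2 <= 4 * n)%N.
  by rewrite q2 -/k in nlo *; rewrite -(prednK k0) expnS leq_mul2l ltnW.
have Xq : (X <= #|F|)%N.
  rewrite -leq_sqr; apply: leq_trans Xn _; by rewrite q2.
have {}nhi : (n <= #|{: F * F}|)%N by rewrite card_prod -[(_ * _)%N]/(#|F| ^ 2)%N q2.
pose iota (i : 'I_n) : F * F := enum_val (widen_ord nhi i).
have iota_inj : injective iota.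
  by move=> i j /enum_val_inj /(congr1 val) /= /val_inj.
set q : R := #|F|%:R; have qX : X%:R <= q by rewrite ler_nat.
have q0 : 0 < q by apply: lt_le_trans qX; rewrite ltr0n.
set N : R := n%:R; have NX : X%:R <= N by rewrite ler_nat (leq_trans Xle).
have N0 : 0 < N by rewrite ltr0n ltnW.
pose s := Num.truncn (p * q).
have /andP [slo shi] : s%:R <= p * q < s.+1%:R.
  by apply: truncn_itv; rewrite mulr_ge0 // ltW.
have sF : (s <= #|[set: F]%SET|)%N.
  rewrite cardsT -(ler_nat R) -/q; apply: (le_trans slo).
  by rewrite ler_piMl // ltW.
have [||S _ Ss] := @exists_subset_between F finset.set0 [set: F]%SET s.
- exact: finset.sub0set.
- by rewrite cards0 leq0n.
have thN : 1 <= th * N.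
  by rewrite mulrC -ler_pdivrMr //; rewrite /Y in XY; lra.
have thq : 1 <= th * q.
  by rewrite mulrC -ler_pdivrMr //; rewrite /Y in XY; lra.
have t2 : 256 <= th ^+ 2 * q.
  by rewrite mulrC -ler_pdivrMr ?exprn_gt0 //; rewrite /Y in XY; lra.
clear XY a0 b0.
pose r (i j : 'I_n) := plane_rel S (iota i) (iota j).
have rs : symmetric r by move=> i j; exact: plane_relC.
have [G0 G0E] := graph_of_rel rs.
have disc (A B : {set 'I_n}) :
    `|\sum_(x in A) \sum_(y in B) ((r x y)%:R - s%:R / q)| <= th * N ^+ 2.
  have := plane_discrepancy R S (iota @: A)%SET (iota @: B)%SET.
  rewrite big_imset /=; last by move=> ? ? _ _; exact: iota_inj.
  under eq_bigr => x _ do (rewrite big_imset /=; last by move=> ? ? _ _; exact: iota_inj).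
  rewrite Ss -/q; set D := \sum_(x in A) _ => D7.
  have thN0 : 0 <= th * N ^+ 2 by rewrite mulr_ge0 ?exprn_ge0 // ltW.
  rewrite -(@ler_pXn2r _ 2) ?nnegrE // real_normK ?num_real //.
  apply: (le_trans D7).
  have qN : q ^+ 2 <= 4 * N.
    by rewrite -natrX -[4]/(4%:R) -natrM ler_nat.
  have q8 : q ^+ 8 <= 256 * N ^+ 4.
    have -> : 256 * N ^+ 4 = (4 * N) ^+ 4 by ring.
    rewrite -[8%N]/(2 * 4)%N exprM; apply: lerXn2r => //.
      by rewrite nnegrE exprn_ge0 // ltW.
    by rewrite nnegrE mulr_ge0 // ltW.
  have h1 : 256 * q ^+ 7 <= th ^+ 2 * q * q ^+ 7.
    by apply: ler_wpM2r => //; rewrite exprn_ge0 // ltW.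
  have h2 : th ^+ 2 * q ^+ 8 <= th ^+ 2 * (256 * N ^+ 4).
    by apply: ler_wpM2l => //; rewrite exprn_ge0 // ltW.
  have -> : (th * N ^+ 2) ^+ 2 = th ^+ 2 * N ^+ 4 by ring.
  lra.
clear t2.
have ABN (A B : {set 'I_n}) : (#|A| * #|B|)%:R <= N ^+ 2 :> R.
  rewrite -natrX ler_nat -[(n ^ 2)%N]/(n * n)%N -[n in (n * n)%N]card_ord.
  by apply: leq_mul; exact: max_card.
have sp : `|s%:R / q - p| <= th.
  have sq : `|s%:R / q - p| * q <= th * q.
    apply: le_trans thq; rewrite -{2}[q]ger0_norm ?ltW // -normrM.
    rewrite mulrBl divfK ?gt_eqF //. rewrite ltr_norml.
    by move: shi; rewrite -natr1; lra.
  by rewrite -(ler_pM2r q0).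
have disc0 (A B : {set 'I_n}) :
    `|edge_sum R (adj G0) A B - p * (#|A| * #|B|)%:R| <= 3 * th * N ^+ 2.
  have -> : edge_sum R (adj G0) A B - p * (#|A| * #|B|)%:R =
      \sum_(x in A) \sum_(y in B) ((r x y)%:R - s%:R / q) +
      (s%:R / q - p) * (#|A| * #|B|)%:R -
      \sum_(x in A) \sum_(y in B) ((x == y) && r x y)%:R.
    rewrite -!sum_area -big_split -!sumrB; apply: eq_bigr => x _ /=.
    rewrite -big_split -!sumrB; apply: eq_bigr => y _ /=.
    by rewrite G0E; case: (x == y); case: (r x y) => /=; ring.
  have h3 : (0 <= (\sum_(x in A) \sum_(y in B) ((x == y) && r x y)%:R : R) <= N)%R.
    apply/andP; split.
      by apply: sumr_ge0 => x _; apply: sumr_ge0 => y _; rewrite ler0n.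
    have -> : N = \sum_(x : 'I_n) 1 by rewrite sumr_const card_ord.
    rewrite [leLHS]big_mkcond; apply: ler_sum => x _ /=; case: ifP => // _.
    apply: (@le_trans _ _ (\sum_(y : 'I_n) (x == y)%:R)).
      rewrite [leLHS]big_mkcond; apply: ler_sum => y _ /=.
      by case: ifP => // _; case: (x == y) => //=; case: (r x y) => /=.
    rewrite (bigD1 x) //= eqxx big1 ?addr0 // => y; by rewrite eq_sym => /negPf ->.
  have h2 : `|(s%:R / q - p) * (#|A| * #|B|)%:R| <= th * N ^+ 2.
    by rewrite normrM; apply: ler_pM => //; rewrite ger0_norm ?ler0n.
  have h4 : N <= th * N ^+ 2 by rewrite expr2 mulrA ler_peMl // ltW.
  have := disc A B; move: h2; rewrite !ler_norml; lra.
have floor_ge0 : 0 <= Num.floor (p * 'C(n, 2)%:R) by rewrite floor_ge0 mulr_ge0 ?ler0n.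
pose t := `|Num.floor (p * 'C(n, 2)%:R)|%N.
have tE : t%:Z = Num.floor (p * 'C(n, 2)%:R) by rewrite /t gez0_abs.
have /andP [tlo thi] : t%:R <= p * 'C(n, 2)%:R < t%:R + 1.
  have := floor_itv (p * 'C(n, 2)%:R); rewrite -tE.
  by rewrite intrD -!pmulrn.
have tC : (t <= 'C(#|'I_n|, 2))%N.
  by rewrite card_ord -(ler_nat R); apply: le_trans tlo _; rewrite ler_piMl ?ler0n.
have [G Gt GG0] := graph_adjust G0 tC.
have C2 : 2 * 'C(n, 2)%:R = N ^+ 2 - N.
  exact: double_bin2.
have E0 : `|2 * #|edges G0|%:R - p * N ^+ 2| <= 3 * th * N ^+ 2.
  have := disc0 [set: 'I_n]%SET [set: 'I_n]%SET.
  rewrite cardsT card_ord natrM -expr2 /edge_sum -sum_adj.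
  congr (`| _ - _ | <= _); apply: eq_big => [x|x _]; first by rewrite inE.
  by apply: eq_bigl => y; rewrite inE.
have hN : N <= th * N ^+ 2 by rewrite expr2 mulrA ler_peMl // ltW.
have near : (dist G0 G)%:R <= 3 * th * N ^+ 2.
  have pN0 : 0 <= p * N by apply: mulr_ge0 => //; exact: ltW.
  have pN1 : p * N <= N by apply: ler_piMl => //; exact: ltW.
  rewrite GG0.
  have N2 : 2 <= N by rewrite (ler_nat R 2).
  have tlo' : 2 * t%:R <= p * (N ^+ 2 - N) by rewrite -C2; lra.
  have thi' : p * (N ^+ 2 - N) < 2 * t%:R + 2 by rewrite -C2; lra.
  case: (leqP t #|edges G0|) => le_t.
    have -> : (t - #|edges G0| = 0)%N by apply/eqP.
    rewrite add0n natrB //; move: E0; rewrite ler_norml; lra.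
  have -> : (#|edges G0| - t = 0)%N by apply/eqP; rewrite subn_eq0 ltnW.
  rewrite addn0 natrB ?(ltnW le_t) //; move: E0; rewrite ler_norml; lra.
exists G; split; first by rewrite Gt.
move=> A B; have := disc0 A B.
have diff : `|edge_sum R (adj G) A B - edge_sum R (adj G0) A B| <= 2 * (dist G0 G)%:R.
  rewrite -sum_dist /edge_sum -sumrB; apply: le_trans (ler_norm_sum _ _ _) _.
  rewrite [leLHS]big_mkcond; apply: ler_sum => x _ /=.
  case: ifP => _; last by apply: sumr_ge0 => y _; rewrite ler0n.
  rewrite -sumrB; apply: le_trans (ler_norm_sum _ _ _) _.
  rewrite [leLHS]big_mkcond; apply: ler_sum => y _ /=; case: ifP => // _.
  by case: (adj G x y); case: (adj G0 x y); rewrite /= ?subrr ?subr0 ?sub0r ?normrN ?normr1 ?normr0.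
have -> : eta = 9 * th by rewrite /th; field.
move: diff; rewrite !ler_norml -/N; lra.
Qed.

(** * Split and co-bipartite recolourings *)

Lemma adj_complete_bipartite (s t : nat) (u v : 'I_s + 'I_t) :
  adj (complete_bipartite s t) u v = (is_inl u != is_inl v).
Proof.
rewrite /adj /=; apply/imsetP/idP.
  move=> [[i j] _ /= e].
  have : inl i \in [set u; v]%SET by rewrite e !inE eqxx.
  have : inr j \in [set u; v]%SET by rewrite e !inE eqxx orbT.
  by case: u v {e} => [x|x] [y|y]; rewrite !inE.
case: u v => [i|i] [j|j] //= _; first by exists (i, j); rewrite ?inE.
by exists (j, i); rewrite ?inE //= finset.setUC.
Qed.

Lemma adj_induced (V : finType) (G : graph V) (S : {set V})
    (x y : {x | x \in S}) :
  adj (Defs.induced G S) x y = adj G (val x) (val y).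
Proof. by rewrite /adj /= inE imsetU1 imset_set1. Qed.

Lemma Forb_K23P (V : finType) (G : graph V) :
  Forb (complete_bipartite 2 3) G <->
  no_K23 (adj G) (fun x y => ~~ adj G x y).
Proof.
split.
  move=> /existsPn H a a' b b' b'' /and4P [naa nbb nbb' nbb''].
  move=> /and4P [eaa ebb ebb' ebb''] /and3P [e1 e2 e3] /and3P [e4 e5 e6].
  pose g (w : 'I_2 + 'I_3) := match w with
    | inl i => if val i == 0 then a else a'
    | inr i => if val i == 0 then b else if val i == 1 then b' else b''
    end%N.
  have adjg u v : adj (complete_bipartite 2 3) u v = adj G (g u) (g v).
    rewrite adj_complete_bipartite.
    have ee x y : adj G x y -> adj G x y = true by [].
    have ees x y : adj G x y -> adj G y x = true by rewrite adj_sym.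
    have nn x y : ~~ adj G x y -> adj G x y = false by move/negPf.
    have nns x y : ~~ adj G x y -> adj G y x = false by rewrite adj_sym => /negPf.
    case: u => [[i]|[i]]; [case: i => [|[|i]] //|case: i => [|[|[|i]]] //] => ilt;
      (case: v => [[j]|[j]]; [case: j => [|[|j]] //|case: j => [|[|[|j]]] //] => jlt);
      by rewrite /g /= ?adj_irr //; symmetry; auto.
  have g_inj : injective g.
    have ne x y : adj G x y -> x = y -> False by move=> xy e; rewrite e adj_irr in xy.
    have nes x y : adj G y x -> x = y -> False by move=> xy e; rewrite e adj_irr in xy.
    have nq (x y : V) : x != y -> x = y -> False by move/eqP.
    have nqs (x y : V) : x != y -> y = x -> False by rewrite eq_sym => /eqP.
    move=> [[i]|[i]]; [case: i => [|[|i]] //|case: i => [|[|[|i]]] //] => ilt;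
      (move=> [[j]|[j]]; [case: j => [|[|j]] //|case: j => [|[|[|j]]] //] => jlt);
      rewrite /g /= => e;
      first [by congr inl; apply: val_inj | by congr inr; apply: val_inj
         | by exfalso; eauto].
  have := H (g @: [set: 'I_2 + 'I_3])%SET; apply/negP; rewrite negbK; apply/existsP.
  pose f := [ffun s : {x | x \in (g @: [set: 'I_2 + 'I_3])%SET} =>
    odflt (inl ord0) [pick u | g u == val s]].
  have gf s : g (f s) = val s.
    rewrite ffunE; case: pickP => [u /eqP //|/= no].
    by have /imsetP [u _ su] := valP s; have := no u; rewrite -su eqxx.
  exists f; apply/and3P; split.
  - apply/injectiveP => s s' e; apply: val_inj; by rewrite -!gf e.
  - apply/forallP => w; have gw : g w \in (g @: [set: 'I_2 + 'I_3])%SET by rewrite imset_f ?inE.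
    apply/codomP; exists (Sub (g w) gw); apply: g_inj; by rewrite gf.
  - apply/forallP => x; apply/forallP => y.
    by rewrite adj_induced adjg !gf.
move=> free; apply/existsPn => S; apply/negP => /existsP [f /and3P [_ /forallP surj]].
move=> /forallP fadj.
have inv w : {s | f s == w}.
  by apply: sigW; have /codomP [s ->] := surj w; exists s.
pose g w := val (sval (inv w)).
have adjg u v : adj G (g u) (g v) = (is_inl u != is_inl v).
  rewrite -adj_complete_bipartite -adj_induced.
  have /forallP /(_ (sval (inv v))) := fadj (sval (inv u)).
  by move=> /eqP ->; rewrite (eqP (svalP (inv u))) (eqP (svalP (inv v))).
have g_inj u v : u != v -> g u != g v.
  apply: contra => /eqP /val_inj e.
  by rewrite -(eqP (svalP (inv u))) -(eqP (svalP (inv v))) e.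
pose r (i : 'I_3) : 'I_2 + 'I_3 := inr i; pose l (i : 'I_2) : 'I_2 + 'I_3 := inl i.
apply: (free (g (l ord0)) (g (l (Ordinal (isT : 1 < 2)%N))) (g (r ord0))
  (g (r (Ordinal (isT : 1 < 3)%N))) (g (r (Ordinal (isT : 2 < 3)%N)))).
- by rewrite !g_inj.
- by rewrite !adjg.
- by rewrite !adjg.
- by rewrite !adjg.
Qed.

(** * Random two-colourings of the vertices *)

Section RandomColouring.

Variables (R : realFieldType) (V : finType) (x : R).

Definition colour_weight (b : bool) : R := if b then x else 1 - x.

Definition colouring_weight (f : {ffun V -> bool}) : R :=
  \prod_v colour_weight (f v).

Lemma sum_colouring_weight : \sum_f colouring_weight f = 1.
Proof.
rewrite /colouring_weight -(bigA_distr_bigA (fun _ b => colour_weight b)) /=.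
by rewrite big1 // => v _; rewrite big_bool /=; ring.
Qed.

Lemma sum_colouring_weight_pair (u v : V) (b : bool) : u != v ->
  \sum_f colouring_weight f * ((f u == b) && (f v == b))%:R =
  colour_weight b ^+ 2.
Proof.
(* Absorbing the indicator into the factors at [u] and [v] keeps the sum over colourings a
   product. *)
move=> uv; pose F w c : R := colour_weight c *
  (if w \in [:: u; v] then (c == b)%:R else 1).
transitivity (\sum_(f : {ffun V -> bool}) \prod_w F w (f w)).
  apply: eq_bigr => f _; rewrite /F big_split /=; congr (_ * _).
  rewrite (bigD1 u) //= (bigD1 v) ?(eq_sym v) //= !inE !eqxx orbT.
  rewrite big1 ?mulr1 => [|w /andP [wu wv]]; first by rewrite -natrM mulnb.
  by rewrite !inE (negPf wu) (negPf wv).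
rewrite -(bigA_distr_bigA F) (bigD1 u) //= (bigD1 v) ?(eq_sym v) //=.
rewrite [X in _ * (_ * X)]big1 => [|w /andP [wu wv]]; last first.
  rewrite big_bool /F !inE (negPf wu) (negPf wv) /= /colour_weight /=; ring.
rewrite !big_bool /F !inE !eqxx orbT /=.
by case: (b) => /=; rewrite /colour_weight /=; ring.
Qed.

Hypothesis x01 : 0 <= x <= 1.

Lemma exists_colouring_le (D : {ffun V -> bool} -> R) :
  exists f, D f <= \sum_f colouring_weight f * D f.
Proof.
set T := \sum_f _; apply/existsP; apply: contraT.
rewrite negb_exists => /forallP H.
have W0 f : 0 <= colouring_weight f.
  have [x0 x1] := andP x01.
  by apply: prodr_ge0 => v _; rewrite /colour_weight; case: ifP; rewrite ?subr_ge0.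
have : 0 < \sum_f colouring_weight f * (D f - T).
  rewrite lt_def; apply/andP; split; last first.
    apply: sumr_ge0 => f _; rewrite mulr_ge0 // subr_ge0 ltW // ltNge; exact: H.
  apply/negP; rewrite psumr_eq0; last first.
    by move=> f _; rewrite mulr_ge0 // subr_ge0 ltW // ltNge; exact: H.
  move=> /allP Z; have := sum_colouring_weight; rewrite big1.
    by move/eqP; rewrite eq_sym oner_eq0.
  move=> f _; have := Z f (mem_index_enum _); rewrite /= mulf_eq0 => /orP [/eqP //|].
  by rewrite subr_eq0 => /eqP e; have := H f; rewrite e lexx.
under eq_bigr do rewrite mulrBr.
by rewrite sumrB -big_distrl /= sum_colouring_weight mul1r subrr ltxx.
Qed.

(** The first moment method. The false class always becomes a clique; [s] says whether the true
    class becomes a clique (co-bipartite) or an independent set (split). *)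
Lemma exists_recolouring (G : graph V) (s : bool) :
  exists f : {ffun V -> bool}, exists G' : graph V,
  (forall u v, adj G' u v = (u != v) &&
     (if f u == f v then f u ==> s else adj G u v)) /\
  (dist G G')%:R <= (if s then 0 else x ^+ 2) * #|edges G|%:R +
    ((1 - x) ^+ 2 + if s then x ^+ 2 else 0) * ('C(#|V|, 2)%:R - #|edges G|%:R).
Proof.
pose r f u v := if f u == f v then f u ==> s else adj G u v.
have G'P (f : {ffun V -> bool}) : exists G' : graph V,
    forall u v, adj G' u v = (u != v) && r f u v.
  apply: graph_of_rel => u v; rewrite /r eq_sym; case: eqP => [->//|_].
  exact: adj_sym.
pose al : R := if s then 0 else x ^+ 2.
pose be : R := (1 - x) ^+ 2 + if s then x ^+ 2 else 0.
pose D (f : {ffun V -> bool}) : R :=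
  \sum_u \sum_v (adj G u v != (u != v) && r f u v)%:R.
have [f fD] := exists_colouring_le D; have [G' G'E] := G'P f.
exists f, G'; split; first exact: G'E.
have : 2 * (dist G G')%:R = D f.
  by rewrite -sum_dist; apply: eq_bigr => u _; apply: eq_bigr => v _; rewrite G'E.
suff ED : \sum_f colouring_weight f * D f =
    2 * (al * #|edges G|%:R + be * ('C(#|V|, 2)%:R - #|edges G|%:R)).
  by move: fD; rewrite ED -/al -/be; lra.
transitivity (\sum_u \sum_v (al * (adj G u v)%:R +
    be * (1 - (u == v)%:R - (adj G u v)%:R))).
  rewrite /D; under eq_bigr do rewrite big_distrr /=.
  rewrite exchange_big; apply: eq_bigr => u _ /=.
  under eq_bigr do rewrite big_distrr /=.
  rewrite exchange_big; apply: eq_bigr => v _ /=.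
  have [->|uv] := eqVneq u v.
    rewrite adj_irr big1 => [|f' _]; last by rewrite /= mulr0.
    by rewrite subrr subr0 !mulr0 addr0.
  pose P b (f' : {ffun V -> bool}) : R := ((f' u == b) && (f' v == b))%:R.
  transitivity (\sum_f' (colouring_weight f' * P true f' * (adj G u v != s)%:R +
      colouring_weight f' * P false f' * (~~ adj G u v)%:R)).
    apply: eq_bigr => f' _; rewrite /P /r /=.
    by case: (f' u); case: (f' v); case: (adj G u v); case: (s) => /=; ring.
  rewrite big_split -!big_distrl /= !sum_colouring_weight_pair //.
  by rewrite /al /be /colour_weight; case: (adj G u v); case: (s) => /=; ring.
have C2 : 2 * 'C(#|V|, 2)%:R + #|V|%:R = #|V|%:R ^+ 2 :> R.
  by rewrite double_bin2 subrK.
have sV : \sum_(u : V) \sum_(v : V) 1 = #|V|%:R ^+ 2 :> R.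
  by under eq_bigr do rewrite sumr_const; rewrite sumr_const -mulrnA -natrX.
have sE : \sum_(u : V) \sum_(v : V) (u == v)%:R = #|V|%:R :> R.
  rewrite -sum1_card natr_sum; apply: eq_bigr => u _.
  rewrite (bigD1 u) //= eqxx big1 ?addr0 // => v.
  by rewrite eq_sym => /negPf ->.
under eq_bigr do rewrite big_split -!big_distrr /= !sumrB.
by rewrite big_split -!big_distrr /= !sumrB sV sE sum_adj -C2; ring.
Qed.

End RandomColouring.

(** A clique meets each side of K_{2,3} at most once. Two cliques cannot cover the three-vertex
    side; next to one clique, the independent class would keep a vertex of each side, and these are
    adjacent. *)
Lemma recolouring_no_K23 (V : finType) (G G' : graph V) (f : V -> bool) (s : bool) :
  (forall u v, adj G' u v =
     (u != v) && (if f u == f v then f u ==> s else adj G u v)) ->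
  no_K23 (adj G') (fun x y => ~~ adj G' x y).
Proof.
move=> G'E a a' b b' b'' /and4P [n1 n2 n3 n4].
rewrite !G'E n1 n2 n3 n4 /=.
case: (s); case: (f a); case: (f a'); case: (f b); case: (f b'); case: (f b'') => //=;
  by rewrite ?andbF.
Qed.

Lemma dist_property_le (P : graph_property) (V : finType) (G G' : graph V) :
  P V G' -> (dist_property P G <= dist G G')%N.
Proof.
rewrite /dist_property; elim: (index_enum _) (mem_index_enum G') => // H s IH.
rewrite inE big_cons => /orP [/eqP <- -> |G's PG']; first exact: geq_minl.
case: ifP => _; last exact: IH.
exact: leq_trans (geq_minr _ _) (IH G's PG').
Qed.

Lemma dist_property_ge (R : realDomainType) (P : graph_property) (V : finType)
    (G : graph V) (m : R) :
  m <= 'C(#|V|, 2)%:R -> (forall G', P V G' -> m <= (dist G G')%:R) ->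
  m <= (dist_property P G)%:R.
Proof.
move=> mC mP; apply: (big_ind (fun k => m <= k%:R)) => // a b ma mb.
by rewrite /minn; case: ifP.
Qed.

(** * The edit distance function *)

Definition ed_value (R : realType) (p : R) : R :=
  Num.min (p * (1 - p)) ((1 - p) / 2).

Local Notation ForbK23 := (Forb (complete_bipartite 2 3)).

(** The additive 1 pays for the rounding in the number of edges. *)
Lemma max_dist_K23_le (R : realType) (p : R) (n : nat) : 0 <= p <= 1 ->
  (max_dist ForbK23 p n)%:R <= ed_value p * 'C(n, 2)%:R + 1.
Proof.
move=> /andP [p0 p1]; set N : R := 'C(n, 2)%:R.
have N0 : 0 <= N by rewrite ler0n.
have v0 : 0 <= ed_value p.
  by rewrite /ed_value le_min mulr_ge0 ?divr_ge0 ?subr_ge0.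
apply: (big_ind (fun k => k%:R <= ed_value p * N + 1)).
- by rewrite addr_ge0 // mulr_ge0.
- by move=> a b ha hb; rewrite /maxn; case: ifP.
move=> G /eqP eG; have := floor_itv (p * N); rewrite -eG intrD -!pmulrn.
set e : R := #|edges G|%:R => /andP [elo ehi].
have bound (x : R) (s : bool) (y : R) : 0 <= x <= 1 ->
    (if s then 0 else x ^+ 2) * e + ((1 - x) ^+ 2 + if s then x ^+ 2 else 0) * (N - e)
    <= y -> (dist_property ForbK23 G)%:R <= y.
  move=> x01 xy; have [f [G' [G'E dG]]] := exists_recolouring x01 G s.
  apply: le_trans xy; apply: le_trans (_ : (dist G G')%:R <= _); last first.
    by move: dG; rewrite card_ord.
  rewrite ler_nat; apply: dist_property_le; apply/Forb_K23P.
  exact: recolouring_no_K23 G'E.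
rewrite /ed_value; case: (lerP (p * (1 - p)) ((1 - p) / 2)) => _.
  (* An independent class of probability [1 - p] edits a share
     [p (1 - p)^2 + (1 - p) p^2 = p (1 - p)]; the co-bipartite case below uses even odds. *)
  apply: (bound (1 - p) false); first by apply/andP; split; lra.
  have h1 : (1 - p) ^+ 2 * e <= (1 - p) ^+ 2 * (p * N) by rewrite ler_wpM2l ?sqr_ge0.
  have h2 : p ^+ 2 * (N - e) <= p ^+ 2 * (N - p * N + 1).
    by rewrite ler_wpM2l ?sqr_ge0 //; lra.
  have h3 : p ^+ 2 <= 1 by rewrite expr_le1.
  lra.
apply: (bound (1 / 2) true); first by apply/andP; split; lra.
lra.
Qed.

Lemma sum_same_residue_le (R : realType) (n m : nat) :
  (0 < m)%N ->
  \sum_(x : 'I_n) \sum_(y : 'I_n) (x == y %[mod m])%:R <=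
  n%:R * (n%:R / m%:R + 1) :> R.
Proof.
move=> m0; have -> : n%:R * (n%:R / m%:R + 1) = \sum_(x : 'I_n) (n%:R / m%:R + 1) :> R.
  by rewrite sumr_const card_ord mulr_natl.
apply: ler_sum => x _; rewrite -natr_sum -big_mkcond sum1_card.
pose f (y : 'I_n) : 'I_(n %/ m).+1 := inord (y %/ m).
have fE y : val (f y) = (y %/ m)%N.
  by rewrite /f /= inordK // ltnS leq_div2r // ltnW.
have le1 : (#|[pred y : 'I_n | x == y %[mod m]]| <= (n %/ m).+1)%N.
  rewrite -[X in (_ <= X)%N]card_ord -(card_in_imset (f := f)); first exact: max_card.
  move=> y z; rewrite !inE => /eqP xy /eqP xz /(congr1 val); rewrite !fE => yz.
  by apply: val_inj; rewrite /= (divn_eq y m) (divn_eq z m) yz -xy xz.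
apply: (@le_trans _ _ ((n %/ m).+1)%:R); first by rewrite ler_nat.
rewrite -natr1 lerD2r ler_pdivlMr ?ltr0n // -natrM ler_nat.
exact: leq_trunc_div.
Qed.

Lemma max_dist_K23_ge (R : realType) (p eps : R) : 0 <= p <= 1 -> 0 < eps ->
  exists n0 : nat, forall n, (n0 <= n)%N ->
  (ed_value p - eps) * 'C(n, 2)%:R <= (max_dist ForbK23 p n)%:R.
Proof.
(* The error terms will total at most [6 * d * n^2], hence [24 * d * N]; edits are counted twice, so
   the loss is [12 * d * N], which 14 covers. *)
move=> p01 eps0; pose d : R := Num.min (eps / 14) (1 / 2).
have [p0 p1] := andP p01.
have d0 : 0 < d by rewrite lt_min !divr_gt0.
have d_eps : 14 * d <= eps by rewrite mulrC -ler_pdivlMr // /d ge_min lexx.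
have d2 : d <= 1 / 2 by rewrite /d ge_min lexx orbT.
have d01 : 0 <= d <= 1 by apply/andP; split; lra.
have d10 : d ^+ 10 <= d.
  by rewrite -[leRHS]expr1; apply: ler_wiXn2l => //; lra.
have d100 : 0 < d ^+ 10 by rewrite exprn_gt0.
pose e : R := d ^+ 10 * (1 / 20) ^+ 2 / 20.
have k0 : 0 < (1 / 20) ^+ 2 :> R by rewrite exprn_gt0 ?divr_gt0.
have k1 : (1 / 20) ^+ 2 <= 1 :> R by rewrite expr_le1 //; lra.
have dk0 : 0 < d ^+ 10 * (1 / 20) ^+ 2 by rewrite mulr_gt0.
have dk1 : d ^+ 10 * (1 / 20) ^+ 2 <= d.
  by apply: le_trans d10; rewrite ler_piMr // ltW.
have e0 : 0 < e by rewrite divr_gt0.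
have ed : 10 * e < d ^+ 10 * (1 / 20) ^+ 2.
  by rewrite /e; move: dk0; set t := _ * _; lra.
have e_d : e <= d by rewrite /e; move: dk0 dk1; set t := _ ^+ 10 * _; lra.
(* Starting from residues modulo [m > 1 / d] leaves at most [d * n^2 + n] pairs inside cells, and
   refinement only lowers this. *)
pose m := (Num.truncn d^-1).+1.
have md : m%:R^-1 <= d.
  rewrite -[leRHS]invrK lef_pV2 ?posrE ?invr_gt0 ?ltr0n //.
  by apply: ltW; exact: truncnS_gt.
have [K KP] := regularity m e0.
(* The discrepancy is paid once for each of at most [K^2] pairs of cells, so it is chosen after
   [K]. *)
pose eta : R := d / (K%:R ^+ 2 + 1).
have K20 : 0 < K%:R ^+ 2 + 1 :> R by rewrite ltr_wpDl ?sqr_ge0.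
have eta0 : 0 < eta by rewrite divr_gt0.
have [n1 n1P] := quasirandom_graph p01 eta0.
pose n2 := (Num.truncn ((40 * K%:R + 1) / d)).+1.
exists (maxn 2 (maxn n1 n2)) => n; rewrite !geq_max => /and3P [n_2 n_n1 n_n2].
have [G [Gp qr]] := n1P n n_n1.
have n2R : 2 <= n%:R :> R by rewrite (ler_nat R 2).
have nd : (40 * K%:R + 1) <= d * n%:R.
  rewrite [d * _]mulrC -ler_pdivrMr //; apply: ltW.
  by apply: lt_le_trans (truncnS_gt _) _; rewrite ler_nat.
set N : R := 'C(n, 2)%:R; have N2 : 2 * N = n%:R ^+ 2 - n%:R by exact: double_bin2.
have N0 : 0 <= N by rewrite ler0n.
have v1 : ed_value p <= 1 by rewrite /ed_value ge_min; apply/orP; right; lra.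
apply: (@le_trans _ _ (dist_property ForbK23 G)%:R); last first.
  by rewrite ler_nat; apply: leq_bigmax_cond; rewrite Gp.
apply: dist_property_ge; first by rewrite card_ord ler_piMl //; lra.
move=> G' /Forb_K23P free.
have m0 : (0 < m)%N by [].
pose c0 (i : 'I_n) : 'I_m := Ordinal (ltn_pmod i m0).
have [C [c [pi [CK cE irr]]]] := KP _ (adj G') c0.
have diag : \sum_x \sum_y (c x == c y)%:R <= d * n%:R ^+ 2 + n%:R :> R.
  apply: (@le_trans _ _ (n%:R * (n%:R / m%:R + 1))).
    apply: le_trans (@sum_same_residue_le R n m m0).
    apply: ler_sum => x _; apply: ler_sum => y _; rewrite ler_nat.
    case: eqP => // cxy; suff -> : x == y %[mod m] by [].
    by have := cE x; rewrite cxy -cE => /(congr1 val) /= ->.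
  rewrite mulrDr mulr1 lerD2r mulrC mulrAC -expr2 mulrC ler_wpM2r ?sqr_ge0 //.
have := @edit_cost_ge R (ordinal n) C (adj G') (adj G) c p d e (eta * n%:R ^+ 2)
  (e * n%:R ^+ 2) (d * n%:R ^+ 2 + n%:R) (adj_sym G') free p01 d01 (ltW e0) ed.
rewrite card_ord in irr *; move=> /(_ (ltnW n_2) qr irr diag).
rewrite sum_dist -/(ed_value p); set D : R := (dist G G')%:R.
have CKR : #|C|%:R <= K%:R :> R by rewrite ler_nat.
have n0 : 0 <= n%:R :> R by rewrite ler0n.
have h1 : 40 * #|C|%:R * n%:R + n%:R <= d * n%:R ^+ 2.
  have := ler_wpM2r n0 nd; have := ler_wpM2r n0 CKR; lra.
have h2 : #|C|%:R ^+ 2 * (eta * n%:R ^+ 2) <= d * n%:R ^+ 2.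
  rewrite mulrA ler_wpM2r ?sqr_ge0 // /eta mulrA ler_pdivrMr // mulrC ler_wpM2l ?(ltW d0) //.
  have : #|C|%:R ^+ 2 <= K%:R ^+ 2 :> R by apply: lerXn2r; rewrite ?nnegrE ?ler0n.
  by lra.
have h3 : e * n%:R ^+ 2 <= d * n%:R ^+ 2 by rewrite ler_wpM2r ?sqr_ge0.
have h4 : n%:R ^+ 2 <= 4 * N.
  have := ler_wpM2r n0 n2R; lra.
have h5 : d * n%:R ^+ 2 <= d * (4 * N) by rewrite ler_wpM2l // ltW.
have h6 : 14 * d * N <= eps * N by rewrite ler_wpM2r.
have v0 : 0 <= ed_value p by rewrite /ed_value le_min mulr_ge0 ?divr_ge0 ?subr_ge0.
have h7 : ed_value p * (2 * N) <= ed_value p * n%:R ^+ 2.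
  by rewrite ler_wpM2l // N2 gerBl.
have h8 : 0 <= d * N by rewrite mulr_ge0 // ltW.
lra.
Qed.

Lemma edit_ratio_K23_cvg (R : realType) (p : R) : 0 <= p <= 1 ->
  (edit_ratio ForbK23 p @ \oo --> ed_value p)%classic.
Proof.
move=> p01; apply/cvgrPdist_le => eps eps0.
have [n0 n0P] := max_dist_K23_ge p01 eps0.
(* This forces [1 / eps <= n - 1 <= N], so the rounding error 1 in the upper bound is at most
   [eps * N]. *)
exists (maxn 2 (maxn n0 (Num.truncn eps^-1).+2)) => // n /=.
rewrite !geq_max => /and3P [n_2 n_n0 n_e].
have nR : eps^-1 <= n%:R - 1.
  have : (Num.truncn eps^-1).+2%:R <= n%:R :> R by rewrite ler_nat.
  have := truncnS_gt eps^-1; rewrite -natr1; lra.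
have n2R : 2 <= n%:R :> R by rewrite (ler_nat R 2).
have := n0P n n_n0; have := max_dist_K23_le n p01; rewrite /edit_ratio.
have := double_bin2 R n; set N : R := 'C(n, 2)%:R; set D : R := _%:R => NE hi lo.
have Nn : n%:R - 1 <= N by nra.
have Ne : eps^-1 <= N by exact: le_trans Nn.
have N0 : 0 < N by apply: lt_le_trans Ne; rewrite invr_gt0.
have Neps : 1 <= eps * N by rewrite mulrC -ler_pdivrMr // div1r.
rewrite ler_norml; apply/andP; split.
  by rewrite lerBrDl -lerBrDr opprK ler_pdivrMr //; lra.
by rewrite lerBlDl -lerBlDr ler_pdivlMr //; lra.
Qed.

Lemma ed_K23 (R : realType) (p : R) : 0 <= p <= 1 ->
  ed ForbK23 p = ed_value p.
Proof. by move=> p01; apply: cvg_lim => //; exact: edit_ratio_K23_cvg. Qed.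

Lemma ed_value_le (R : realType) (p : R) : ed_value p <= 1 / 4.
Proof.
rewrite /ed_value ge_min; apply/orP; left.
by have := sqr_ge0 (p - 1 / 2); lra.
Qed.

Lemma ed_value_half (R : realType) : ed_value (1 / 2) = 1 / 4 :> R.
Proof. by rewrite /ed_value; case: lerP; lra. Qed.

Unset Implicit Arguments.

Local Open Scope classical_set_scope.

(** Convergence accompanies the value because [ed] is a [limn], which by itself would not certify
    that the limit exists. *)
Theorem theorem3 (R : realType) :
  let H := Forb (complete_bipartite 2 3) in
  (forall p : R, 0 <= p <= 1 ->
     cvgn (edit_ratio H p) /\
     ed H p = Num.min (p * (1 - p)) ((1 - p) / 2)) /\
  p_star R H = [set 1 / 2] /\
  d_star R H = 1 / 4.
Proof.
move=> H; have half01 : 0 <= (1 / 2 : R) <= 1 by apply/andP; split; lra.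
split=> [p p01|].
  split; last exact: ed_K23.
  by apply/cvg_ex; exists (ed_value p); exact: edit_ratio_K23_cvg.
split.
  apply/seteqP; split=> p /=.
    move=> [p01 /(_ _ half01)]; rewrite !ed_K23 // ed_value_half => le_p.
    have : 1 / 4 <= p * (1 - p) by apply: le_trans le_p _; rewrite ge_min lexx.
    (* [1 / 4 <= p * (1 - p)] says that the square of [p - 1 / 2] is at most 0. *)
    move=> h; apply/eqP; rewrite -subr_eq0 -sqrf_eq0 eq_le sqr_ge0 andbT; lra.
  move=> ->; split=> // q q01; rewrite !ed_K23 // ed_value_half.
  exact: ed_value_le.
have max14 : ([set ed H p | p in [set p : R | 0 <= p <= 1]] `&`
    ubound [set ed H p | p in [set p : R | 0 <= p <= 1]]) (1 / 4).
  split=> /=; first by exists (1 / 2) => //; rewrite ed_K23 // ed_value_half.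
  by move=> _ [p p01 <-]; rewrite ed_K23 //; exact: ed_value_le.
apply: xget_unique => // y [yv yu]; apply/eqP; rewrite eq_le.
by rewrite (max14.2 _ yv) (yu _ max14.1).
Qed.
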